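(* (1) For all integers $n\ge 3$, $\tau(n,0)=\max\{1,n-4\}$. (2) Up to isomorphism, the quasilinear betweenness structures (of order $n \ge 3$) are the following: - $\mathcal{R}_{n,i}^4$ for $n\ge 5$ and $i\in I_n^4$; - $\mathcal{S}_n^4$ for $n\ge 5$; - the betweenness structures $\mathcal{B}(G)$ where $G$ is one of the following eight graphs: the complete graph $K_3$; the star $K_{1,3}$; the weighted $4$-cycle whose edge weights in cyclic order are $1,1,2,2$; the complete bipartite graph $K_{2,3}$; the complete bipartite graph $K_{3,3}$; $K_{3,3}$ with one edge deleted; $K_{3,3}$ with two disjoint edges deleted; the cycle $C_6$ (all edge weights are $1$ except in the weighted $4$-cycle).
   Context: A betweenness structure is a pair $\mathcal{B}=(X,\beta)$ where $X$ is a nonempty finite set and $\beta\subseteq X^3$; write $(x\ y\ z)$ for $(x,y,z)\in\beta$. All betweenness structures are assumed to be almost-metrizable, i.e. for all $x,y,z,w\in X$: (P1) $(x\ x\ z)$; (P2) $(x\ y\ z)\Rightarrow(z\ y\ x)$; (P3) $(x\ y\ z)\wedge(y\ x\ z)\Rightarrow x=y$; (P4) $(x\ y\ z)\wedge(x\ w\ y)\Rightarrow(x\ w\ z)\wedge(w\ y\ z)$. The order of $\mathcal{B}$ is $|X|$. A set of three distinct points is collinear if some ordering of it is in $\beta$; otherwise it is a triangle. The co-size of $\mathcal{B}$ is its number of triangles. $B(n,m)$ is the set of betweenness structures of order $n$ and co-size $m$. Isomorphisms are bijections of ground sets preserving betweenness in both directions. $\tau(n,k)=\min\{m>k: B(n,m)\ne\emptyset\}$.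 A betweenness structure of order $n$ is quasilinear if its co-size equals $\tau(n,0)$, i.e. it has at least one triangle and has minimum co-size among the structures of order $n$ having a triangle. Graphs are connected with positive real edge weights (weight $1$ unless specified). For a graph $W$ with shortest-path metric $d_W$ (path length is the sum of edge weights), the betweenness structure $\mathcal{B}(W)$ induced by $W$ lives on the vertex set and has $(x\ y\ z)$ iff $d_W(x,z)=d_W(x,y)+d_W(y,z)$. Let $I_n^4=\{i\in\mathbb{N}:1\le i\le\lceil\frac{n-3}{2}\rceil\}$. The following graphs have vertex set $\{x_1,\dots,x_{n-2},y,z\}$ and are obtained from the path $P=x_1x_2\ldots x_{n-2}$: - $R_{n,i}^4$ ($n\ge5$, $i\in I_n^4$): delete edge $\{x_i,x_{i+1}\}$ from $P$ and add edges $\{y,x_i\},\{z,x_i\},\{y,x_{i+1}\},\{z,x_{i+1}\}$; - $S_n^4$ ($n\ge5$): add edges $\{x_1,y\}$, $\{x_{n-2},z\}$, and add edge $\{y,z\}$ of weight $n-3$. $\mathcal{R}_{n,i}^4$ and $\mathcal{S}_n^4$ are the betweenness structures induced by $R_{n,i}^4$ and $S_n^4$. *)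

(* Defs.v *)
From mathcomp Require Import all_boot all_order all_algebra.
From mathcomp Require Import classical_sets reals.
From mathcomp Require Import ring lra zify.
Set Implicit Arguments.
Unset Strict Implicit.
Unset Printing Implicit Defensive.
Import Order.TTheory GRing.Theory Num.Theory.

(* [btw x y z] stands for [(x y z)], i.e. [y] lies between [x] and [z]. *)
Record betweenness := Betweenness {
  pt :> finType;
  btw : pt -> pt -> pt -> bool;
  pt_gt0 : 0 < #|pt|;
  btwP1 : forall x z, btw x x z;
  btwP2 : forall x y z, btw x y z -> btw z y x;
  btwP3 : forall x y z, btw x y z -> btw y x z -> x = y;
  btwP4 : forall x y z w, btw x y z -> btw x w y -> btw x w z /\ btw w y z
}.

Definition collinear (B : betweenness) (A : {set B}) : bool :=
  [exists x, exists y, exists z, (A == [set x; y; z]) && btw x y z].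

Definition triangle (B : betweenness) (A : {set B}) : bool :=
  (#|A| == 3) && ~~ collinear A.

Definition cosize (B : betweenness) : nat := #|[pred A : {set B} | triangle A]|.

Definition isomorphic (B C : betweenness) : Prop :=
  exists2 f : B -> C, bijective f &
    forall x y z, btw (f x) (f y) (f z) = btw x y z.

(* The set B(n, m) is nonempty. *)
Definition realizable (n m : nat) : Prop :=
  exists2 B : betweenness, #|B| = n & cosize B = m.

(* [is_tau n k m] says that the minimum defining tau(n, k) exists and is [m]. *)
Definition is_tau (n k m : nat) : Prop :=
  [/\ k < m, realizable n m &
      forall m', k < m' -> realizable n m' -> m <= m'].

Definition quasilinear (B : betweenness) : Prop := is_tau #|B| 0 (cosize B).

Local Open Scope ring_scope.

(* The values of [weight] on pairs that are not edges are irrelevant. *)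
Record wgraph (R : realType) := WGraph {
  vert :> finType;
  edge : rel vert;
  weight : vert -> vert -> R;
  vert_gt0 : (0 < #|vert|)%N;
  edge_irr : irreflexive edge;
  edge_sym : symmetric edge;
  weight_sym : forall u v, edge u v -> weight u v = weight v u;
  weight_gt0 : forall u v, edge u v -> 0 < weight u v;
  edge_conn : forall u v, connect edge u v
}.

Section Distance.
Variables (R : realType) (W : wgraph R).
Implicit Types (u v x y z : W) (p : seq W).

(* Length of the walk [u :: p]. *)
Fixpoint walk_length (u : W) (p : seq W) : R :=
  if p is v :: p' then weight u v + walk_length v p' else 0.

Definition simple_path (u v : W) (p : seq W) : bool :=
  [&& path (@edge R W) u p, last u p == v & uniq (u :: p)].

(* The set of lengths is finite and nonempty, so that [inf] is a minimum. *)
Definition dist (u v : W) : R :=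
  inf [set walk_length u p | p in [set p | simple_path u v p]]%classic.

Lemma walk_length_ge0 u p : path (@edge R W) u p -> 0 <= walk_length u p.
Proof.
elim: p u => //= v p IH u /andP[euv pv].
by rewrite addr_ge0 ?IH // ltW // weight_gt0.
Qed.

Lemma walk_length_cat u p q :
  walk_length u (p ++ q) = walk_length u p + walk_length (last u p) q.
Proof. by elim: p u => [|v p IH] u /=; rewrite ?add0r // IH addrA. Qed.

Lemma walk_length_rev u p : path (@edge R W) u p ->
  walk_length (last u p) (rev (belast u p)) = walk_length u p.
Proof.
elim: p u => //= v p IH u /andP[euv pv].
rewrite rev_cons -cats1 walk_length_cat IH //=.
have -> : last (last v p) (rev (belast v p)) = v.
  by case: p {IH pv} => //= w p; rewrite rev_cons last_rcons.
by rewrite addr0 addrC (weight_sym euv).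
Qed.

Lemma walk_shorten u p : path (@edge R W) u p ->
  exists2 q, simple_path u (last u p) q & walk_length u q <= walk_length u p.
Proof.
elim: p u => [|v p IH] u /=.
  by exists [::]; rewrite /simple_path //= eqxx.
case/andP=> euv /IH[q /and3P[pq /eqP lq uq] leq].
have [uin|unin] := boolP (u \in v :: q); last first.
  exists (v :: q); last by rewrite /= lerD2l.
  by apply/and3P; split=> /=; rewrite ?euv ?lq ?eqxx // unin.
have wge : 0 <= weight u v by rewrite ltW // weight_gt0.
case/splitPl: uin pq lq uq leq => q1 q2 lq1.
rewrite cat_path last_cat lq1 walk_length_cat lq1 => /andP[p1 p2] lq.
rewrite -cat_cons cat_uniq lastI lq1 rcons_uniq.
case/and3P=> /andP[_ _] /hasPn hn uq2 leq.
exists q2; last by have := walk_length_ge0 p1; lra.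
apply/and3P; split=> //; first exact/eqP.
rewrite cons_uniq uq2 andbT; apply/negP => /hn.
by rewrite mem_rcons mem_head.
Qed.

Lemma dist_has_inf u v :
  has_inf [set walk_length u p | p in [set p | simple_path u v p]]%classic.
Proof.
split; last first.
  by exists 0 => _ [p /= /and3P[pp _ _] <-]; apply: walk_length_ge0.
have /connectP[p pp ->] := edge_conn u v.
have [q sq _] := walk_shorten pp.
by exists (walk_length u q), q.
Qed.

Lemma dist_le_walk u p :
  path (@edge R W) u p -> dist u (last u p) <= walk_length u p.
Proof.
move=> pp; have [q sq] := walk_shorten pp; apply: le_trans.
by apply: ge_inf; [case: (dist_has_inf u (last u p)) | exists q].
Qed.

Lemma dist_ge u v (c : R) :
  (forall p, simple_path u v p -> c <= walk_length u p) -> c <= dist u v.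
Proof.
move=> cle; apply: lb_le_inf; first by case: (dist_has_inf u v).
by move=> _ [p /= sp <-]; apply: cle.
Qed.

Lemma dist_ge0 u v : 0 <= dist u v.
Proof. by apply: dist_ge => p /and3P[pp _ _]; apply: walk_length_ge0. Qed.

Lemma distxx u : dist u u = 0.
Proof.
by apply/eqP; rewrite eq_le dist_ge0 andbT; apply: (@dist_le_walk u [::]).
Qed.

Lemma dist_sym u v : dist u v = dist v u.
Proof.
have le x y : dist x y <= dist y x.
  apply: dist_ge => p /and3P[pp /eqP lp _].
  rewrite -(walk_length_rev pp) lp.
  have pr : path (@edge R W) x (rev (belast y p)).
    rewrite -lp rev_path (eq_path (e' := @edge R W)) // => a b.
    exact: edge_sym.
  suff ly : last x (rev (belast y p)) = y.
    by have := dist_le_walk pr; rewrite ly.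
  by case: p lp {pp pr} => [|w p] //= _; rewrite rev_cons last_rcons.
by apply/eqP; rewrite eq_le !le.
Qed.

Lemma dist_triangle x y z : dist x z <= dist x y + dist y z.
Proof.
rewrite -lerBlDr; apply: dist_ge => p /and3P[pp /eqP lp _].
rewrite lerBlDr addrC -lerBlDr; apply: dist_ge => q /and3P[pq /eqP lq _].
rewrite lerBlDr addrC.
have := @dist_le_walk x (p ++ q).
by rewrite last_cat walk_length_cat cat_path lp lq pp pq; apply.
Qed.

Lemma dist_eq0 u v : dist u v = 0 -> u = v.
Proof.
apply: contra_eq => uv; rewrite gt_eqF //.
pose m : R := \big[Num.min/1]_(e : W * W | edge e.1 e.2) weight e.1 e.2.
have m0 : 0 < m by apply: lt_bigmin => // e; apply: weight_gt0.
apply: (lt_le_trans m0); apply: dist_ge => -[|w p] /and3P[/=].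
  by move=> _ uv'; rewrite uv' in uv.
case/andP=> euw pw _ _.
apply: (@le_trans _ _ (weight u w)); last by rewrite lerDl walk_length_ge0.
exact: (@bigmin_le_cond _ _ _ _ (u, w)).
Qed.

Definition metric_btw (x y z : W) : bool := dist x z == dist x y + dist y z.

Lemma metric_btwP1 x z : metric_btw x x z.
Proof. by rewrite /metric_btw distxx add0r. Qed.

Lemma metric_btwP2 x y z : metric_btw x y z -> metric_btw z y x.
Proof.
move=> /eqP h; apply/eqP.
by rewrite (dist_sym z x) h addrC (dist_sym x) (dist_sym y).
Qed.

Lemma metric_btwP3 x y z : metric_btw x y z -> metric_btw y x z -> x = y.
Proof.
move=> /eqP h1 /eqP h2; apply: dist_eq0.
by move: h1 h2; rewrite (dist_sym y x); lra.
Qed.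

Lemma metric_btwP4 x y z w :
  metric_btw x y z -> metric_btw x w y -> metric_btw x w z /\ metric_btw w y z.
Proof.
move=> /eqP h1 /eqP h2.
have := dist_triangle x w z; have := dist_triangle w y z.
by split; apply/eqP; lra.
Qed.

Definition induced : betweenness :=
  Betweenness (vert_gt0 W) metric_btwP1 metric_btwP2 metric_btwP3 metric_btwP4.

End Distance.

Lemma connected_rank (V : finType) (e : rel V) (r : V -> nat) (o : V) :
  symmetric e -> (forall v, v != o -> exists2 u, e u v & (r u < r v)%N) ->
  forall u v, connect e u v.
Proof.
move=> es dec; have co v : connect e o v.
  have [n] := ubnP (r v); elim: n v => // n IH v rv.
  have [->|/dec[u euv ruv]] := eqVneq v o; first exact: connect0.
  apply: connect_trans (connect1 euv); apply: IH; lia.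
move=> u v; apply: connect_trans (co v).
by rewrite (sym_connect_sym es) co.
Qed.

Definition unit_graph (R : realType) (V : finType) (e : rel V)
    (V_gt0 : (0 < #|V|)%N) (e_irr : irreflexive e) (e_sym : symmetric e)
    (e_conn : forall u v, connect e u v) : wgraph R :=
  @WGraph R V e (fun _ _ => 1) V_gt0 e_irr e_sym
    (fun _ _ _ => erefl) (fun _ _ _ => ltr01) e_conn.

Lemma card_sum_gt0 (A B : finType) (b : B) : (0 < #|{: A + B}|)%N.
Proof. by apply/card_gt0P; exists (inr b). Qed.

(* In [R4] and [S4], [inl a] is the vertex x_(a+1) (0 <= a < n - 2),
   [inr false] is y and [inr true] is z. *)
Definition R4_edge (n i : nat) : rel ('I_(n - 2) + bool)%type :=
  fun u v => match u, v with
  | inl a, inl b => [|| (b == a.+1 :> nat) && (a.+1 != i)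
                      | (a == b.+1 :> nat) && (b.+1 != i)]
  | inl a, inr _ | inr _, inl a => (a.+1 == i) || (a.+1 == i.+1)
  | inr _, inr _ => false
  end.

(* The set I_n^4; [uphalf m] is the ceiling of m / 2. *)
Definition I4 (n i : nat) : bool := (1 <= i <= uphalf (n - 3))%N.

Section R4.
Variables (R : realType) (n i : nat).
Hypotheses (n_ge5 : (5 <= n)%N) (iI : I4 n i).

Lemma R4_irr : irreflexive (@R4_edge n i).
Proof. by case=> //= a; rewrite ltn_eqF. Qed.

Lemma R4_sym : symmetric (@R4_edge n i).
Proof. by case=> [a|a] [b|b] //=; rewrite orbC. Qed.

Lemma R4_conn u v : connect (@R4_edge n i) u v.
Proof.
pose r (u : ('I_(n - 2) + bool)%type) : nat := match u with
  | inl a => if (a < i)%N then (i - a)%N else (a - i).+1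
  | inr b => b.*2 end.
move: u v; apply: (@connected_rank _ _ r (inr false) R4_sym).
move: iI; rewrite /I4 => iI'; case=> [a|[]] // _ /=.
- have [ai|ai] := ltnP a i.
    have [aE|aN] := eqVneq a.+1 i.
      by exists (inr false) => /=; rewrite ?aE ?eqxx //; lia.
    have h : (a.+1 < n - 2)%N by lia.
    by exists (inl (Ordinal h)) => /=; last case: ifP; lia.
  have [aE|aN] := eqVneq (a : nat) i.
    by exists (inr false) => /=; lia.
  have h : (a.-1 < n - 2)%N by have := ltn_ord a; lia.
  by exists (inl (Ordinal h)) => /=; last case: ifP; lia.
have h : (i.-1 < n - 2)%N by lia.
by exists (inl (Ordinal h)) => /=; last case: ifP; lia.
Qed.

Definition R4 : wgraph R :=
  unit_graph R (card_sum_gt0 _ false) R4_irr R4_sym R4_conn.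

End R4.

Definition S4_edge (n : nat) : rel ('I_(n - 2) + bool)%type :=
  fun u v => match u, v with
  | inl a, inl b => (b == a.+1 :> nat) || (a == b.+1 :> nat)
  | inl a, inr c | inr c, inl a => if c then a.+1 == (n - 2)%N else a.+1 == 1%N
  | inr c, inr d => c != d
  end.

Definition S4_weight (R : realType) (n : nat) (u v : 'I_(n - 2) + bool) : R :=
  if (u, v) is (inr _, inr _) then (n - 3)%N%:R else 1.

Section S4.
Variables (R : realType) (n : nat).
Hypothesis n_ge5 : (5 <= n)%N.

Lemma S4_irr : irreflexive (@S4_edge n).
Proof. by case=> [a|b] /=; rewrite ?eqxx // ltn_eqF. Qed.

Lemma S4_sym : symmetric (@S4_edge n).
Proof. by case=> [a|a] [b|b] //=; rewrite 1?orbC 1?eq_sym // orbC eq_sym. Qed.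

Lemma S4_weight_sym (u v : 'I_(n - 2) + bool) :
  S4_edge u v -> S4_weight R u v = S4_weight R v u.
Proof. by case: u v => [a|a] [b|b]. Qed.

Lemma S4_weight_gt0 (u v : 'I_(n - 2) + bool) :
  S4_edge u v -> 0 < S4_weight R u v.
Proof. by case: u v => [a|a] [b|b] //= _; rewrite ltr0n; lia. Qed.

Lemma S4_conn u v : connect (@S4_edge n) u v.
Proof.
pose r (u : ('I_(n - 2) + bool)%type) : nat := match u with
  | inl a => a.+1 | inr b => b end.
move: u v; apply: (@connected_rank _ _ r (inr false) S4_sym).
case=> [a|[]] // _ /=; last by exists (inr false).
have [a0|a0] := posnP a; first by exists (inr false) => //=; rewrite a0.
have h : (a.-1 < n - 2)%N by have := ltn_ord a; lia.
by exists (inl (Ordinal h)) => /=; lia.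
Qed.

Definition S4 : wgraph R :=
  WGraph (card_sum_gt0 _ false) S4_irr S4_sym S4_weight_sym S4_weight_gt0
    S4_conn.

End S4.

Section Complete.
Variables (R : realType) (n : nat).

Definition complete_edge : rel 'I_n.+1 := fun u v => u != v.

Lemma complete_irr : irreflexive complete_edge.
Proof. by move=> u; rewrite /complete_edge eqxx. Qed.

Lemma complete_sym : symmetric complete_edge.
Proof. by move=> u v; rewrite /complete_edge eq_sym. Qed.

Lemma complete_conn u v : connect complete_edge u v.
Proof.
by have [->|uv] := eqVneq u v; [apply: connect0 | apply: connect1].
Qed.

Lemma ord_gt0 : (0 < #|'I_n.+1|)%N.
Proof. by rewrite card_ord. Qed.

(* The complete graph on n + 1 vertices. *)
Definition complete_graph : wgraph R :=
  unit_graph R ord_gt0 complete_irr complete_sym complete_conn.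

End Complete.

(* The complete bipartite graph with parts of sizes [m] and [n], from which the
   edges {inl k, inr k} with k < d are deleted. *)
Definition bip_edge (m n d : nat) : rel ('I_m + 'I_n)%type :=
  fun u v => match u, v with
  | inl a, inr b | inr b, inl a => ~~ ((a == b :> nat) && (a < d)%N)
  | _, _ => false
  end.

Lemma bip_irr m n d : irreflexive (@bip_edge m n d).
Proof. by case. Qed.

Lemma bip_sym m n d : symmetric (@bip_edge m n d).
Proof. by case=> [a|a] [b|b]. Qed.

Section Bipartite.
Variables (R : realType) (m n : nat).

Lemma bip_conn0 u v : connect (@bip_edge m.+1 n.+1 0) u v.
Proof.
pose r (u : ('I_m.+1 + 'I_n.+1)%type) : nat := match u with
  | inl a => if a == ord0 then 0 else 2 | inr b => 1 end.
move: u v; apply: (@connected_rank _ _ r (inl ord0) (@bip_sym _ _ _)).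
case=> [a|b] ab; last by exists (inl ord0) => //=; rewrite ltn0 andbF.
exists (inr ord0) => /=; first by rewrite ltn0 andbF.
by case: ifP => // /eqP aE; rewrite aE eqxx in ab.
Qed.

(* The complete bipartite graph with parts of sizes m + 1 and n + 1. *)
Definition complete_bipartite : wgraph R :=
  unit_graph R (card_sum_gt0 _ ord0) (@bip_irr _ _ _) (@bip_sym _ _ _)
    bip_conn0.

End Bipartite.

Section K33.
Variables (R : realType) (d : nat).
Hypothesis d_le2 : (d <= 2)%N.

Lemma K33_del_conn u v : connect (@bip_edge 3 3 d) u v.
Proof.
pose r (u : ('I_3 + 'I_3)%type) : nat := match u with
  | inl a => if a == ord_max then 0 else 2 | inr b => 1 end.
move: u v; apply: (@connected_rank _ _ r (inl ord_max) (@bip_sym _ _ _)).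
case=> [a|b] ab; last by exists (inl ord_max) => //=; lia.
exists (inr ord_max) => /=; first by lia.
by case: ifP => // /eqP aE; rewrite aE eqxx in ab.
Qed.

(* K_{3,3} with [d] pairwise disjoint edges deleted. *)
Definition K33_del : wgraph R :=
  unit_graph R (card_sum_gt0 _ ord0) (@bip_irr _ _ _) (@bip_sym _ _ _)
    K33_del_conn.

End K33.

Section Cycle.
Variables (R : realType) (n : nat) (c : 'I_n.+3 -> R).
Hypothesis c_gt0 : forall k, 0 < c k.

Definition cycle_edge : rel 'I_n.+3 :=
  fun u v => (v == ordS u) || (u == ordS v).

Definition cycle_weight (u v : 'I_n.+3) : R := if v == ordS u then c u else c v.

Lemma ordS_neq (u : 'I_n.+3) : u != ordS u.
Proof.
apply/eqP => /(congr1 val) /= h; have := ltn_ord u.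
rewrite ltnS leq_eqVlt => /orP[/eqP un|un].
  by move: h; rewrite un modnn.
by move: h; rewrite modn_small //; lia.
Qed.

Lemma ordSS_neq (u : 'I_n.+3) : u != ordS (ordS u).
Proof.
apply/eqP => /(congr1 val) /= h; have := ltn_ord u; move: h.
move: (nat_of_ord u) => k; rewrite -[X in (X %% _)%N]addn1 modnDml addn1.
have [u1|u1] := ltnP k.+2 n.+3; first by rewrite modn_small //; lia.
by move=> + kn; rewrite -(subnK u1) modnDr modn_small; lia.
Qed.

Lemma cycle_irr : irreflexive cycle_edge.
Proof. by move=> u; rewrite /cycle_edge orbb (negbTE (ordS_neq u)). Qed.

Lemma cycle_sym : symmetric cycle_edge.
Proof. by move=> u v; rewrite /cycle_edge orbC. Qed.

Lemma cycle_weight_sym u v :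
  cycle_edge u v -> cycle_weight u v = cycle_weight v u.
Proof.
rewrite /cycle_weight => /orP[] /eqP ->; rewrite eqxx.
  by rewrite (negbTE (ordSS_neq u)).
by rewrite (negbTE (ordSS_neq v)).
Qed.

Lemma cycle_weight_gt0 u v : cycle_edge u v -> 0 < cycle_weight u v.
Proof. by rewrite /cycle_weight; case: ifP. Qed.

Lemma cycle_conn u v : connect cycle_edge u v.
Proof.
move: u v; apply: (@connected_rank _ _ val ord0 cycle_sym) => v v0.
have {}v0 : (0 < v)%N.
  by rewrite lt0n; apply: contra v0 => /eqP v0; apply/eqP/val_inj.
have h : (v.-1 < n.+3)%N by have := ltn_ord v; lia.
exists (Ordinal h) => /=; last by lia.
apply/orP; left; apply/eqP/val_inj => /=.
by rewrite prednK // modn_small.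
Qed.

(* The cycle on n + 3 vertices whose edge {k, k + 1} has weight [c k]. *)
Definition cycle_graph : wgraph R :=
  WGraph (ord_gt0 n.+2) cycle_irr cycle_sym cycle_weight_sym cycle_weight_gt0
    cycle_conn.

End Cycle.

Section NamedGraphs.
Variable R : realType.

Definition K3 : wgraph R := complete_graph R 2.
Definition K13 : wgraph R := complete_bipartite R 0 2.
Definition K23 : wgraph R := complete_bipartite R 1 2.
Definition K33 : wgraph R := complete_bipartite R 2 2.
Definition K33_minus1 : wgraph R := @K33_del R 1 isT.
Definition K33_minus2 : wgraph R := @K33_del R 2 isT.

Definition C6 : wgraph R :=
  @cycle_graph R 3 (fun _ => 1) (fun _ => ltr01).

Definition C4_1122_weight (k : 'I_4) : R := if (k < 2)%N then 1 else 2.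

Lemma C4_1122_weight_gt0 k : 0 < C4_1122_weight k.
Proof. by rewrite /C4_1122_weight; case: ifP; rewrite ?ltr01 ?ltr0n. Qed.

(* The 4-cycle with edge weights 1, 1, 2, 2 in cyclic order. *)
Definition C4_1122 : wgraph R := cycle_graph C4_1122_weight_gt0.

End NamedGraphs.

(* Main.v *)
Require Import Defs.
From mathcomp Require Import all_boot all_order all_algebra reals.
From mathcomp Require Import zify.
Set Implicit Arguments.
Unset Strict Implicit.
Unset Printing Implicit Defensive.

(* The structures of order at most 6 with few triangles are found by a verified
   exhaustive search, adding one point at a time. In particular no structure of
   order 6 has exactly one triangle; deleting points, every structure of order
   n >= 6 with a triangle has at least n - 4 of them. If there are exactly n - 4
   and n >= 7, deleting a point leaves no triangle or at least n - 5 of them, so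
   each point lies in none, one or all of the triangles, and double counting
   yields two points y and z common to all. A triangle-free structure of order at
   least 5 is a path, so that the points other than y and z form a path into which
   y and z can be inserted separately. As y and z are collinear with exactly two
   points of the path, they are either twins inside the path (the family R) or
   extend it at opposite ends (the family S). *)

(** * Exhaustive search *)

(** The searches stay small because a point of a triangle can be deleted: a structure with at most t
    + 1 triangles extends one with at most t by a single point, so no base with more than one
    triangle is ever extended. They need to be complete, not exact: the labels of the given
    structure must survive as one branch, and a spurious branch could only make the computation
    fail. The double counting reads 3(n - 4) <= f(n - 4) + (n - f), where f points lie in all
    triangles. It excludes f = 0 for n >= 7 and f = 1 for n >= 8; the case n = 7, f = 1 needs one
    more fact from the search, that the two triangles of a six-point structure with exactly two
    never share exactly one point. Paths need five points because the 4-cycle is triangle-free. The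
    identification with R and S checks only that the collinearities of the model hold in the given
    structure; equality of the co-sizes gives the converse. *)

Definition label (T : Type) (b : T -> T -> T -> bool) (x y z : T) : nat :=
  if b x y z then 1 else if b y x z then 0 else if b x z y then 2 else 3.

(* [f i j l], meaningful for [i < j < l], names the middle point of the triple:
   0 for [i], 1 for [j], 2 for [l]; 3 stands for a triangle and 4 for a label
   that is not known yet. *)
Definition middle (f : nat -> nat -> nat -> nat) (x y z : nat) : bool :=
  let a := minn x z in let c := maxn x z in
  if y < a then f y a c == 0 else if y < c then f a y c == 1 else f a c y == 2.

Lemma eq_middle k f g i j l :
  (forall i j l, i < j -> j < l -> l < k -> f i j l = g i j l) ->
  i < k -> j < k -> l < k -> i != j -> j != l -> i != l ->
  middle f i j l = middle g i j l.
Proof.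
move=> fg ik jk lk ij jl il; rewrite /middle /=.
have [il'|li] := ltnP i l.
  by case: ifP => ?; last (case: ifP => ?); rewrite fg //; lia.
by case: ifP => ?; last (case: ifP => ?); rewrite fg //; lia.
Qed.

(** The order matters to the pruning in [search]: with [j] outermost and [i] innermost, the other
    triples of a quadruple h < i < j < l all precede (i, j, l), those through [l] in this layer and
    (h, i, j) in an earlier one. So each quadruple can be checked in full at its last triple. *)
Definition layer (l : nat) : seq (nat * nat * nat) :=
  flatten [seq [seq (i, j, l) | i <- iota 0 j] | j <- iota 0 l].

Definition triples (k : nat) : seq (nat * nat * nat) :=
  flatten [seq layer l | l <- iota 0 k].

Lemma mem_layer i j l l' :
  ((i, j, l) \in layer l') = [&& i < j, j < l & l == l'].
Proof.
apply/flatten_mapP/and3P.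
  case=> j'; rewrite mem_iota add0n => /andP[_ jl] /mapP[i'].
  by rewrite mem_iota add0n => /andP[_ ij] [-> -> ->]; rewrite ij jl eqxx.
case=> ij jl /eqP <-; exists j; first by rewrite mem_iota.
by apply/mapP; exists i; rewrite ?mem_iota.
Qed.

Lemma mem_triples i j l k :
  ((i, j, l) \in triples k) = [&& i < j, j < l & l < k].
Proof.
apply/flatten_mapP/and3P.
  case=> l'; rewrite mem_iota add0n mem_layer => /andP[_ lk].
  by case/and3P=> -> -> /eqP ->.
case=> ij jl lk; exists l; first by rewrite mem_iota.
by rewrite mem_layer ij jl eqxx.
Qed.

Lemma triplesS k : triples k.+1 = triples k ++ layer k.
Proof. by rewrite /triples -addn1 iotaD map_cat flatten_cat /= cats0. Qed.

(** [a], [b], [c], [d] are the labels of 012, 013, 023 and 123. *)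
Definition label4 (a b c d i j l : nat) : nat :=
  if l == 2 then a else if j == 1 then b else if i == 0 then c else d.

(** (P4) on four distinct points. A label names at most one middle point and [middle] is symmetric
    in its ends, so (P2) and (P3) are built into the encoding. *)
Definition valid_labels (a b c d : nat) : bool :=
  let f := label4 a b c d in
  all (fun p => if p is [:: x; y; z; w] then
      middle f x y z && middle f x w y ==> middle f x w z && middle f w y z
    else true)
    (permutations (iota 0 4)).

(** Evaluated once, since the search consults these 256 values at its nodes. *)
Definition valid_table : seq (seq (seq (seq bool))) :=
  Eval vm_compute in
    [seq [seq [seq [seq valid_labels a b c d | d <- iota 0 4]
      | c <- iota 0 4] | b <- iota 0 4] | a <- iota 0 4].

(** A quadruple with a label that is not known yet is never rejected. *)
Definition valid4 (a b c d : nat) : bool :=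
  if [&& a < 4, b < 4, c < 4 & d < 4] then
    nth true (nth [::] (nth [::] (nth [::] valid_table a) b) c) d
  else true.

Lemma valid4E a b c d :
  (a < 4 -> b < 4 -> c < 4 -> d < 4 -> valid_labels a b c d) -> valid4 a b c d.
Proof.
rewrite /valid4; case: ifP => // /and4P[a4 b4 c4 d4] /(_ a4 b4 c4 d4).
move: a b c d a4 b4 c4 d4.
move=> [|[|[|[|a]]]] // [|[|[|[|b]]]] // [|[|[|[|c]]]] // [|[|[|[|d]]]] // _ _ _ _.
all: by vm_compute.
Qed.

(** Nested conditionals, because [&&] would evaluate both arguments under call by value. *)
Definition update (f : nat -> nat -> nat -> nat) (i j l c i' j' l' : nat) : nat :=
  if l' == l then if j' == j then if i' == i then c
  else f i' j' l' else f i' j' l' else f i' j' l'.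

(* Backtracking over the labels of the triples [todo], allowing at most [t]
   triangles among them; succeeds if [goal] holds at every leaf. *)
Section Search.
Variable goal : (nat -> nat -> nat -> nat) -> bool.

Fixpoint search (t : nat) (todo : seq (nat * nat * nat))
    (f : nat -> nat -> nat -> nat) : bool :=
  if todo is (i, j, l) :: todo' then
    all (fun c =>
      let f' := update f i j l c in
      if all (fun h => valid4 (f' h i j) (f' h i l) (f' h j l) c) (iota 0 i)
      then if c == 3 then if t is t'.+1 then search t' todo' f' else true
           else search t todo' f'
      else true) (iota 0 4)
  else goal f.

Lemma searchE t i j l todo f : search t ((i, j, l) :: todo) f =
  all (fun c =>
    if all (fun h => let f' := update f i j l c in
        valid4 (f' h i j) (f' h i l) (f' h j l) c) (iota 0 i)
    then if c == 3 then if t is t'.+1 then search t' todo (update f i j l c)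
         else true else search t todo (update f i j l c)
    else true) (iota 0 4).
Proof. by []. Qed.

End Search.

(** * Soundness of the search for an actual betweenness structure *)

Section Code.
Variable B : betweenness.
Implicit Types (x y z w : B) (s : seq B).

Lemma btw_xyy x y : btw x y y.
Proof. exact/btwP2/btwP1. Qed.

Lemma btw_xyx x y : btw x y x -> x = y.
Proof. by move=> xyx; apply: (btwP3 xyx); apply/btwP2/btwP1. Qed.

Lemma btw_sym x y z : btw x y z = btw z y x.
Proof. by apply/idP/idP => /btwP2. Qed.

Lemma label_lt4 x y z : label (@btw B) x y z < 4.
Proof. by rewrite /label; do 3?case: ifP. Qed.

(** [label] tests the middle position first, so recognizing another position takes distinct points
    and (P3) to refute the earlier tests. *)
Lemma label0 x y z : y != x -> (label (@btw B) x y z == 0) = btw y x z.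
Proof.
rewrite /label => yx; case: ifP => [xyz|_]; last by do 2?case: ifP.
by apply/esym/negP => yxz; rewrite (btwP3 xyz yxz) eqxx in yx.
Qed.

Lemma label1 x y z : (label (@btw B) x y z == 1) = btw x y z.
Proof. by rewrite /label; do 3?case: ifP. Qed.

Lemma label2 x y z : x != z -> y != z -> (label (@btw B) x y z == 2) = btw x z y.
Proof.
rewrite /label => xz yz; case: ifP => [/btwP2 zyx|_].
  apply/esym/negP => /btwP2 yzx; by rewrite (btwP3 zyx yzx) eqxx in yz.
case: ifP => [/btwP2 zxy|_]; last by case: ifP.
by apply/esym/negP => xzy; rewrite (btwP3 zxy xzy) eqxx in xz.
Qed.

Definition code (x0 : B) s (i j l : nat) : nat :=
  label (@btw B) (nth x0 s i) (nth x0 s j) (nth x0 s l).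

Section Middle.
Variables (x0 : B) (s : seq B).
Hypothesis s_uniq : uniq s.
Local Notation "s_[ i ]" := (nth x0 s i).

Lemma middle_code i j l : i < size s -> j < size s -> l < size s ->
  i != j -> j != l -> i != l ->
  middle (code x0 s) i j l = btw s_[i] s_[j] s_[l].
Proof.
move=> si sj sl ij jl il.
wlog lt_il : i l si sl ij jl il / i < l.
  move=> h; have [?|?] := ltnP i l; first exact: h.
  rewrite btw_sym -h // 1?eq_sym //; last by lia.
  by rewrite /middle minnC maxnC.
have -> : middle (code x0 s) i j l = if j < i then code x0 s j i l == 0
    else if j < l then code x0 s i j l == 1 else code x0 s i l j == 2.
  by rewrite /middle (minn_idPl (ltnW lt_il)) (maxn_idPr (ltnW lt_il)).
rewrite /code; case: ifP => [ji|]; first by rewrite label0 // nth_uniq.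
move=> _; case: ifP => _; first by rewrite label1.
by rewrite label2 // nth_uniq // eq_sym.
Qed.

End Middle.

Lemma valid_code x0 s h i j l : uniq s ->
  h < i -> i < j -> j < l -> l < size s ->
  valid_labels (code x0 s h i j) (code x0 s h i l) (code x0 s h j l)
    (code x0 s i j l).
Proof.
move=> s_uniq hi ij jl ls; pose t := [seq nth x0 s k | k <- [:: h; i; j; l]].
have lts u : u \in [:: h; i; j; l] -> u < size s by rewrite !inE; lia.
have t_uniq : uniq t.
  rewrite /t map_inj_in_uniq; first by rewrite /= !inE; lia.
  by move=> u v /lts us /lts vs /eqP; rewrite nth_uniq // => /eqP.
rewrite /valid_labels; set f := label4 _ _ _ _.
have fE u v q : u < v -> v < q -> q < 4 -> f u v q = code x0 t u v q.
  by move: u v q => [|[|[|[|u]]]] [|[|[|[|v]]]] [|[|[|[|q]]]].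
apply/allP => p; rewrite mem_permutations => pp; have sp := perm_size pp.
rewrite /= in sp; move: p sp pp => [|x [|y [|z [|w [|? ?]]]]] // _ pp.
have : uniq [:: x; y; z; w] by rewrite (perm_uniq pp).
rewrite /= !inE !negb_or => /and4P[/and3P[xy xz xw] /andP[yz yw] zw _].
have lt4 u : u \in [:: x; y; z; w] -> u < 4 by rewrite (perm_mem pp) mem_iota.
have x4 : x < 4 by rewrite lt4 // !inE eqxx.
have y4 : y < 4 by rewrite lt4 // !inE eqxx !orbT.
have z4 : z < 4 by rewrite lt4 // !inE eqxx !orbT.
have w4 : w < 4 by rewrite lt4 // !inE eqxx !orbT.
have mE u v q : u < 4 -> v < 4 -> q < 4 -> u != v -> v != q -> u != q ->
    middle f u v q = btw (nth x0 t u) (nth x0 t v) (nth x0 t q).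
  move=> u4 v4 q4 uv vq uq; rewrite -middle_code //.
  exact: (@eq_middle 4).
rewrite !mE // 1?(eq_sym w y) 1?(eq_sym w z) // 1?(eq_sym w) //.
by apply/implyP => /andP[xyz xwy]; apply/andP; apply: btwP4 xyz xwy.
Qed.

Lemma search_sound goal x0 s t todo f : uniq s ->
  (forall i j l, (i, j, l) \in todo -> [/\ i < j, j < l & l < size s]) ->
  (forall i j l, i < j -> j < l -> l < size s ->
     f i j l = code x0 s i j l \/ 3 < f i j l /\ (i, j, l) \in todo) ->
  count (fun p => code x0 s p.1.1 p.1.2 p.2 == 3) todo <= t ->
  search goal t todo f ->
  exists2 g, goal g &
    forall i j l, i < j -> j < l -> l < size s -> g i j l = code x0 s i j l.
Proof.
move=> s_uniq; elim: todo t f => [|[[i j] l] todo IH] t f todo_ok f_ok cnt.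
  by exists f => //= i j l ij jl ls; case: (f_ok _ _ _ ij jl ls) => [|[]].
have [ij jl ls] := todo_ok i j l (mem_head _ _).
move: cnt; set c := code x0 s i j l => cnt.
have c4 : c < 4 by apply: label_lt4.
rewrite searchE => /allP /(_ c); rewrite mem_iota => /(_ c4).
set f' := update f i j l c.
have f'_ok i' j' l' : i' < j' -> j' < l' -> l' < size s ->
     f' i' j' l' = code x0 s i' j' l' \/ 3 < f' i' j' l' /\ (i', j', l') \in todo.
  move=> i'j' j'l' l's; rewrite /f' /update.
  have [[-> -> ->]|ne] := eqVneq (i', j', l') (i, j, l).
    by rewrite !eqxx; left.
  have -> : (if l' == l then if j' == j then if i' == i then c else f i' j' l'
    else f i' j' l' else f i' j' l') = f i' j' l'.
    case: eqP => // l'E; case: eqP => // j'E; case: eqP => // i'E.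
    by rewrite l'E j'E i'E eqxx in ne.
  case: (f_ok _ _ _ i'j' j'l' l's) => [|[f4]]; first by left.
  by rewrite inE (negbTE ne); right.
have -> : all (fun h => valid4 (f' h i j) (f' h i l) (f' h j l) c) (iota 0 i).
  apply/allP => h; rewrite mem_iota => /= hi; apply: valid4E.
  have fE u v q : u < v -> v < q -> q < size s -> f' u v q < 4 ->
      f' u v q = code x0 s u v q.
    by move=> uv vq qs; case: (f'_ok _ _ _ uv vq qs) => // -[f4 _]; lia.
  move=> h1 h2 h3 _; have hj := ltn_trans hi ij; have js := ltn_trans jl ls.
  rewrite (fE _ _ _ hi ij js h1) (fE _ _ _ hi (ltn_trans ij jl) ls h2).
  rewrite (fE _ _ _ hj jl ls h3); exact: valid_code.
have todo'_ok i' j' l' : (i', j', l') \in todo -> [/\ i' < j', j' < l' & l' < size s].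
  by move=> h; apply: todo_ok; rewrite inE h orbT.
move: cnt; rewrite [count _ _]/= -/c; case: ifP => [c3|_].
  case: t => [|t] cnt; first by lia.
  by apply: IH.
by move=> cnt; apply: IH.
Qed.
End Code.

(** * Counting triangles *)

Lemma uniq_layer l : uniq (layer l).
Proof.
apply: allpairs_uniq_dep; rewrite ?iota_uniq //.
  by move=> j _; apply: iota_uniq.
by move=> [j i] [j' i'] _ _ /= [-> ->].
Qed.

Lemma uniq_triples k : uniq (triples k).
Proof.
elim: k => // k IH; rewrite triplesS cat_uniq IH uniq_layer andbT /=.
apply/hasPn => -[[i j] l]; rewrite mem_layer mem_triples.
by case/and3P=> _ _ /eqP ->; rewrite ltnn !andbF.
Qed.

Section Triangles.
Variable B : betweenness.
Implicit Types (x y z : B) (s : seq B) (A S : {set B}).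

Definition triangles S : {set {set B}} := [set A | triangle A & A \subset S].

Lemma cards3 (T : finType) (x y z : T) :
  (#|[set x; y; z]| == 3) = [&& x != y, y != z & x != z].
Proof.
have [-> | xy] := eqVneq x y; first by rewrite setUid cards2; case: (_ != _).
have [->|yz] := eqVneq y z; first by rewrite -setUA setUid cards2; case: (_ != _).
have [->|xz] := eqVneq x z.
  by rewrite setUAC setUid cards2; case: (_ != _).
rewrite /= setUC cardsU1 cards2 xy !inE negb_or.
by rewrite (eq_sym z x) (eq_sym z y) xz yz.
Qed.

Lemma collinear3 x y z : x != y -> y != z -> x != z ->
  collinear [set x; y; z] = [|| btw x y z, btw y x z | btw x z y].
Proof.
move=> xy yz xz; apply/existsP/or3P; last first.
  case=> h.
  - by exists x; apply/existsP; exists y; apply/existsP; exists z; rewrite eqxx.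
  - exists y; apply/existsP; exists x; apply/existsP; exists z.
    by rewrite h andbT (setUC [set x]).
  - exists x; apply/existsP; exists z; apply/existsP; exists y.
    by rewrite h andbT setUAC.
case=> a /existsP[b /existsP[c /andP[/eqP E abc]]].
have card3 : #|[set a; b; c]| == 3 by rewrite -E cards3 xy yz xz.
move: card3; rewrite cards3 => /and3P[ab bc ac].
have /set1P : a \in [set a] by rewrite inE.
have : a \in [set x; y; z] by rewrite E !inE eqxx.
have : b \in [set x; y; z] by rewrite E !inE eqxx orbT.
have : c \in [set x; y; z] by rewrite E !inE eqxx orbT.
rewrite !inE -!orbA => /or3P[] /eqP cE /or3P[] /eqP bE /or3P[] /eqP aE _;
  subst a b c; rewrite ?eqxx // in ab bc ac *.
all: by [left | left; apply: btwP2 | right; left | right; left; apply: btwP2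
  | right; right | right; right; apply: btwP2 | apply: Or31 | apply/Or31/btwP2
  | apply: Or32 | apply/Or32/btwP2 | apply: Or33 | apply/Or33/btwP2].
Qed.

Lemma triangle3 x y z : x != y -> y != z -> x != z ->
  triangle [set x; y; z] = (label (@btw B) x y z == 3).
Proof.
move=> xy yz xz; rewrite /triangle cards3 xy yz xz collinear3 //= /label.
by do 3?case: ifP.
Qed.

Section Enumeration.
Variables (x0 : B) (s : seq B).
Hypothesis s_uniq : uniq s.

Definition triple_set (p : nat * nat * nat) : {set B} :=
  [set nth x0 s p.1.1; nth x0 s p.1.2; nth x0 s p.2].

(** Both index triples are strictly increasing lists with the same members, hence equal. *)
Lemma triple_set_inj : {in triples (size s) &, injective triple_set}.
Proof.
move=> [[i j] l] [[i' j'] l']; rewrite !mem_triples.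
case/and3P=> ij jl ls /and3P[ij' jl' ls'] E.
have js := ltn_trans jl ls; have js' := ltn_trans jl' ls'.
have is_ := ltn_trans ij js; have is' := ltn_trans ij' js'.
have key k : k < size s -> (k \in [:: i; j; l]) = (k \in [:: i'; j'; l']).
  move=> ks; have := congr1 (fun A : {set B} => nth x0 s k \in A) E.
  by rewrite /triple_set !inE !nth_uniq // -!orbA.
have outside k u v w : size s <= k -> u < size s -> v < size s -> w < size s ->
    (k \in [:: u; v; w]) = false.
  by move=> sk us vs ws; rewrite !inE; apply/negbTE; lia.
suff [-> -> ->] : [:: i; j; l] = [:: i'; j'; l'] by [].
apply: (irr_sorted_eq ltn_trans ltnn); rewrite /= ?ij ?jl ?ij' ?jl' // => k.
by have [sk|/key //] := leqP (size s) k; rewrite !outside.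
Qed.

Lemma triple_setP A : #|A| = 3 -> A \subset [set x in s] ->
  exists2 p, p \in triples (size s) & A = triple_set p.
Proof.
move=> cA sub; pose t := [seq i <- iota 0 (size s) | nth x0 s i \in A].
have tE : [seq nth x0 s i | i <- t] = [seq x <- s | x \in A].
  by rewrite -[in RHS](mkseq_nth x0 s) /mkseq filter_map.
have tA : [seq nth x0 s i | i <- t] =i A.
  move=> x; rewrite tE mem_filter; apply: andb_idr => /(subsetP sub).
  by rewrite inE.
have st : size t = 3.
  rewrite -cA -(eq_card tA) -(size_map (nth x0 s) t); apply/esym/card_uniqP.
  by rewrite tE filter_uniq.
have : sorted ltn t by apply: sorted_filter (iota_ltn_sorted _ _); apply: ltn_trans.
have : {subset t <= iota 0 (size s)} by apply/mem_subseq/filter_subseq.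
move: t st tA {tE} => [|i [|j [|l [|? ?]]]] //= _ tA sb /and3P[ij jl _].
exists (i, j, l).
  rewrite mem_triples ij jl; have := sb l; rewrite mem_iota /= !inE eqxx !orbT.
  by apply.
by apply/setP => x; rewrite -tA !inE orbA.
Qed.

Lemma triangle_triple p : p \in triples (size s) ->
  triangle (triple_set p) = (code x0 s p.1.1 p.1.2 p.2 == 3).
Proof.
case: p => [[i j] l]; rewrite mem_triples => /and3P[ij jl ls].
have js := ltn_trans jl ls; have is_ := ltn_trans ij js.
by rewrite triangle3 ?nth_uniq // neq_ltn ?ij ?jl // (ltn_trans ij jl).
Qed.

Lemma trianglesE : triangles [set x in s] =i
  [seq triple_set p | p <- triples (size s) & code x0 s p.1.1 p.1.2 p.2 == 3].
Proof.
move=> A; rewrite !inE; apply/andP/mapP.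
  case=> trA sub; have /andP[/eqP cA _] := trA.
  have [p pt AE] := triple_setP cA sub; exists p => //.
  by rewrite mem_filter pt andbT -triangle_triple // -AE.
case=> [p]; rewrite mem_filter => /andP[cp pt] ->; rewrite triangle_triple //.
split=> //; apply/subsetP => x; case: p pt {cp} => [[i j] l].
rewrite mem_triples /triple_set !inE => /and3P[ij jl ls].
have js := ltn_trans jl ls; have is_ := ltn_trans ij js.
by rewrite -orbA => /or3P[] /eqP ->; rewrite mem_nth.
Qed.

(** Turns a number of triangles into a count over the list that the search runs through; this is how
    a bound on triangles becomes the budget [t]. *)
Lemma card_triangles : #|triangles [set x in s]| =
  count (fun p => code x0 s p.1.1 p.1.2 p.2 == 3) (triples (size s)).
Proof.
rewrite (eq_card trianglesE) (card_uniqP _) ?size_map ?size_filter //.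
rewrite map_inj_in_uniq ?filter_uniq ?uniq_triples // => p q.
by rewrite !mem_filter => /andP[_ +] /andP[_ +]; apply: triple_set_inj.
Qed.
End Enumeration.

Lemma cosizeE : cosize B = #|triangles setT|.
Proof. by apply: eq_card => A; rewrite !inE subsetT andbT. Qed.

Lemma triangles_sub S S' : S \subset S' -> triangles S \subset triangles S'.
Proof.
move=> sub; apply/subsetP => A; rewrite !inE => /andP[-> sA].
exact: subset_trans sA sub.
Qed.

Lemma trianglesD1 S x : triangles (S :\ x) = [set A in triangles S | x \notin A].
Proof. by apply/setP => A; rewrite !inE subsetD1 andbA. Qed.

Definition degree S x := #|[set A in triangles S | x \in A]|.

Lemma card_trianglesD1 S x :
  #|triangles S| = degree S x + #|triangles (S :\ x)|.
Proof.
rewrite trianglesD1 /degree.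
have -> : [set A in triangles S | x \notin A] =
    triangles S :\: [set A : {set B} | x \in A].
  by apply/setP => A; rewrite !inE andbC.
have -> : [set A in triangles S | x \in A] =
    triangles S :&: [set A : {set B} | x \in A].
  by apply/setP => A; rewrite !inE.
by rewrite cardsID.
Qed.

Lemma sum_degree S : \sum_(x in S) degree S x = 3 * #|triangles S|.
Proof.
have degE x : degree S x = \sum_(A in triangles S) (x \in A).
  by rewrite /degree -sum1dep_card big_mkcondr /=; apply: eq_bigr => A _; case: in_mem.
rewrite (eq_bigr _ (fun x _ => degE x)) exchange_big /= mulnC -sum_nat_const.
apply: eq_bigr => A; rewrite inE => /andP[/andP[/eqP cA _] /subsetP sub].
have -> : 3 = \sum_(x in S | x \in A) 1.
  rewrite sum1dep_card -cA; apply: eq_card => x; rewrite !inE.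
  by rewrite andb_idl // => /sub.
by rewrite big_mkcondr /=; apply: eq_bigr => x _; case: in_mem.
Qed.

Lemma degree_gt0 S x : 0 < degree S x -> x \in S.
Proof.
case/card_gt0P => A; rewrite !inE => /andP[/andP[_ /subsetP sub]]; exact: sub.
Qed.

Lemma exists_degree_gt0 S : 0 < #|triangles S| ->
  exists2 x, x \in S & 0 < degree S x.
Proof.
case/card_gt0P => A; rewrite inE => /andP[trA sub].
have /card_gt0P[x xA] : 0 < #|A| by case/andP: trA => /eqP ->.
exists x; first exact: (subsetP sub).
by apply/card_gt0P; exists A; rewrite !inE trA sub.
Qed.

End Triangles.

(** * Small orders *)

(* [d] is the table of distances of a graph with vertices 0, 1, ... *)
Definition entry (d : seq (seq nat)) (i j : nat) : nat := nth 0 (nth [::] d i) j.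

Definition table_btw (d : seq (seq nat)) (i j l : nat) : bool :=
  entry d i l == entry d i j + entry d j l.

Definition known (d : seq (seq nat)) (k i j l : nat) : nat :=
  if l < k then label (table_btw d) i j l else 4.

Definition distinct_triples (k : nat) : seq (nat * nat * nat) :=
  [seq p <- [seq (p, l) | p <- [seq (i, j) | i <- iota 0 k, j <- iota 0 k],
                          l <- iota 0 k]
   | if p.1.1 == p.1.2 then false else if p.1.2 == p.2 then false
     else p.1.1 != p.2].

(** [find] with a comparison of sizes replaces [all] here and [has] below, which would not stop
    early under call by value. *)
Definition matches (d : seq (seq nat)) (ts : seq (nat * nat * nat))
    (f : nat -> nat -> nat -> nat) (r : seq nat) : bool :=
  let differs p := middle f (nth 0 r p.1.1) (nth 0 r p.1.2) (nth 0 r p.2)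
    != table_btw d p.1.1 p.1.2 p.2 in
  if find differs ts < size ts then false else true.

Definition isomorphic_to (k : nat) (f : nat -> nat -> nat -> nat)
    (d : seq (seq nat)) : bool :=
  let rs := permutations (iota 0 k) in
  let ts := distinct_triples k in
  if find (matches d ts f) rs < size rs then true else false.

Definition tblK2 := [:: [:: 0; 1]; [:: 1; 0]].
Definition tblK3 := [:: [:: 0; 1; 1]; [:: 1; 0; 1]; [:: 1; 1; 0]].
Definition tblP3 := [:: [:: 0; 1; 2]; [:: 1; 0; 1]; [:: 2; 1; 0]].
Definition tblP4 :=
  [:: [:: 0; 1; 2; 3]; [:: 1; 0; 1; 2]; [:: 2; 1; 0; 1]; [:: 3; 2; 1; 0]].
Definition tblC4 :=
  [:: [:: 0; 1; 2; 1]; [:: 1; 0; 1; 2]; [:: 2; 1; 0; 1]; [:: 1; 2; 1; 0]].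
Definition tblK13 :=
  [:: [:: 0; 1; 1; 1]; [:: 1; 0; 2; 2]; [:: 1; 2; 0; 2]; [:: 1; 2; 2; 0]].
Definition tblC4_1122 :=
  [:: [:: 0; 1; 2; 2]; [:: 1; 0; 1; 3]; [:: 2; 1; 0; 2]; [:: 2; 3; 2; 0]].
Definition tblP5 :=
  [:: [:: 0; 1; 2; 3; 4]; [:: 1; 0; 1; 2; 3]; [:: 2; 1; 0; 1; 2];
      [:: 3; 2; 1; 0; 1]; [:: 4; 3; 2; 1; 0]].
Definition tblK23 :=
  [:: [:: 0; 2; 1; 1; 1]; [:: 2; 0; 1; 1; 1]; [:: 1; 1; 0; 2; 2];
      [:: 1; 1; 2; 0; 2]; [:: 1; 1; 2; 2; 0]].
(* The last two points of [tblR5] and [tblS5] are y and z. *)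
Definition tblR5 :=
  [:: [:: 0; 2; 3; 1; 1]; [:: 2; 0; 1; 1; 1]; [:: 3; 1; 0; 2; 2];
      [:: 1; 1; 2; 0; 2]; [:: 1; 1; 2; 2; 0]].
Definition tblS5 :=
  [:: [:: 0; 1; 2; 1; 3]; [:: 1; 0; 1; 2; 2]; [:: 2; 1; 0; 3; 1];
      [:: 1; 2; 3; 0; 2]; [:: 3; 2; 1; 2; 0]].
Definition tblK33 :=
  [:: [:: 0; 2; 2; 1; 1; 1]; [:: 2; 0; 2; 1; 1; 1]; [:: 2; 2; 0; 1; 1; 1];
      [:: 1; 1; 1; 0; 2; 2]; [:: 1; 1; 1; 2; 0; 2]; [:: 1; 1; 1; 2; 2; 0]].
Definition tblK33_minus1 :=
  [:: [:: 0; 2; 2; 3; 1; 1]; [:: 2; 0; 2; 1; 1; 1]; [:: 2; 2; 0; 1; 1; 1];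
      [:: 3; 1; 1; 0; 2; 2]; [:: 1; 1; 1; 2; 0; 2]; [:: 1; 1; 1; 2; 2; 0]].
Definition tblK33_minus2 :=
  [:: [:: 0; 2; 2; 3; 1; 1]; [:: 2; 0; 2; 1; 3; 1]; [:: 2; 2; 0; 1; 1; 1];
      [:: 3; 1; 1; 0; 2; 2]; [:: 1; 3; 1; 2; 0; 2]; [:: 1; 1; 1; 2; 2; 0]].
Definition tblC6 :=
  [:: [:: 0; 1; 2; 3; 2; 1]; [:: 1; 0; 1; 2; 3; 2]; [:: 2; 1; 0; 1; 2; 3];
      [:: 3; 2; 1; 0; 1; 2]; [:: 2; 3; 2; 1; 0; 1]; [:: 1; 2; 3; 2; 1; 0]].

Definition triangle_triples (k : nat) (f : nat -> nat -> nat -> nat) :=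
  [seq p <- triples k | f p.1.1 p.1.2 p.2 == 3].

Definition common (p q : nat * nat * nat) : seq nat :=
  [seq i <- [:: p.1.1; p.1.2; p.2] | i \in [:: q.1.1; q.1.2; q.2]].

(** [order3], [order4] and [order5] turn out to be all the structures of these orders with at most
    one triangle. Triangle-free among them are one path per order and, at order 4 only, the
    4-cycle. *)
Definition order3 := [:: tblP3; tblK3].
Definition order4 := [:: tblP4; tblC4; tblK13; tblC4_1122].
Definition order5 := [:: tblP5; tblK23; tblR5; tblS5].
Definition order6 := [:: tblK33; tblK33_minus1; tblK33_minus2; tblC6].

Definition some_isomorphic (k : nat) (ds : seq (seq (seq nat)))
  (f : nat -> nat -> nat -> nat) : bool := has (isomorphic_to k f) ds.

(* With two triangles, either these share two points or the structure is one of
   the four of [order6], whose triangles are disjoint. *)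
Definition order6_goal (f : nat -> nat -> nat -> nat) : bool :=
  match triangle_triples 6 f with
  | [::] => true
  | [:: p; q] => let c := size (common p q) in
    if c == 2 then true else if c == 1 then false
    else has (isomorphic_to 6 f) order6
  | _ => false
  end.

Definition ntri (d : seq (seq nat)) (k : nat) : nat :=
  count (fun p => label (table_btw d) p.1.1 p.1.2 p.2 == 3) (triples k).

(** [t] bounds the triangles of the extended structure, so those already present in [d] are
    subtracted. *)
Definition extensions (k t : nat) (g : (nat -> nat -> nat -> nat) -> bool)
    (d : seq (seq nat)) : bool :=
  search g (t - ntri d k) (layer k) (known d k).

Lemma extensions2 : extensions 2 1 (some_isomorphic 3 order3) tblK2.
Proof. by vm_compute. Qed.

Lemma extensions3 : extensions 3 1 (some_isomorphic 4 order4) tblP3.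
Proof. by vm_compute. Qed.

Lemma extensions4 : all (extensions 4 1 (some_isomorphic 5 order5)) [:: tblP4; tblC4].
Proof. by vm_compute. Qed.

Lemma extensions5 : all (extensions 5 2 order6_goal) order5.
Proof. by vm_compute. Qed.

(* The extra point of [insertion4] is the last one. *)
Lemma insertion4 : extensions 4 0 (fun f => if middle f 0 4 3 then
    ~~ middle f 4 0 1 && ~~ middle f 4 0 2 else true) tblP4.
Proof. by vm_compute. Qed.


(** * Tables realized by enumerations, and the structures of order at most 5 *)

Section Realization.
Variable B : betweenness.
Implicit Types (x y z : B) (s : seq B) (S : {set B}) (d : seq (seq nat)).

(** Only distinct indices are constrained: on repeated points betweenness is the same in every
    structure. *)
Definition realizes d s := forall x0 i j l,
  i < size s -> j < size s -> l < size s -> i != j -> j != l -> i != l ->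
  btw (nth x0 s i) (nth x0 s j) (nth x0 s l) = table_btw d i j l.

Lemma realizes_code d s x0 i j l : realizes d s -> i < j -> j < l -> l < size s ->
  code x0 s i j l = label (table_btw d) i j l.
Proof.
move=> ds ij jl ls; rewrite /code /label.
have js := ltn_trans jl ls; have is_ := ltn_trans ij js.
have il := ltn_trans ij jl.
by rewrite !ds // neq_ltn ?ij ?jl ?il ?orbT.
Qed.

Lemma card_triangles_realizes d s : uniq s -> realizes d s ->
  #|triangles [set x in s]| = ntri d (size s).
Proof.
have /card_gt0P[x0 _] := pt_gt0 B.
move=> us ds; rewrite (card_triangles x0) //; apply: eq_in_count => -[[i j] l].
rewrite mem_triples => /and3P[ij jl ls].
by rewrite (realizes_code _ ds).
Qed.

Lemma extension_sound x0 d s x t g : uniq (rcons s x) -> realizes d s ->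
  #|triangles [set y in rcons s x]| <= t -> extensions (size s) t g d ->
  exists2 f, g f & forall i j l, i < j -> j < l -> l < size (rcons s x) ->
    f i j l = code x0 (rcons s x) i j l.
Proof.
move=> us ds ct; have us' : uniq s by move: us; rewrite rcons_uniq => /andP[].
have codeE i j l : i < j -> j < l -> l < size s ->
    code x0 (rcons s x) i j l = label (table_btw d) i j l.
  move=> ij jl ls; rewrite -(realizes_code x0 ds) // /code !nth_rcons ls.
  by rewrite (ltn_trans jl ls) (ltn_trans ij (ltn_trans jl ls)).
apply: search_sound => // [i j l|i j l ij jl|].
- by rewrite mem_layer size_rcons => /and3P[ij jl /eqP <-].
- rewrite size_rcons ltnS leq_eqVlt => /orP[/eqP lE|ls].
    by right; rewrite /known mem_layer ij jl -lE ltnn eqxx.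
  by left; rewrite /known ls codeE.
move: ct; rewrite (card_triangles x0) // size_rcons triplesS count_cat.
(* The old points account for exactly [ntri d] triangles, which leaves the budget of [extensions]
   for the new layer. *)
rewrite [X in X + _ <= t](_ : _ = ntri d (size s)).
  by clear; lia.
apply: eq_in_count => -[[i j] l]; rewrite mem_triples => /and3P[ij jl ls].
by rewrite codeE.
Qed.

Lemma mem_distinct_triples k i j l : ((i, j, l) \in distinct_triples k) =
  [&& i < k, j < k, l < k, i != j, j != l & i != l].
Proof.
rewrite mem_filter /=; apply/andP/and5P.
  case=> h /allpairsP[[p l'] /= [/allpairsP[[i' j'] /= [hi hj ->]] hl [iE jE lE]]].
  move: hi hj hl; rewrite -iE -jE -lE !mem_iota /= => ik jk lk.
  by move: h; case: eqVneq => // ij; case: eqVneq => // jl il; split.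
case=> ik jk lk ij /andP[jl il]; rewrite (negbTE ij) (negbTE jl) il; split=> //.
apply/allpairsP; exists ((i, j), l); split; rewrite ?mem_iota //=.
by apply/allpairsP; exists (i, j); split; rewrite ?mem_iota.
Qed.

Lemma isomorphic_toP x0 s f d : uniq s ->
  (forall i j l, i < j -> j < l -> l < size s -> f i j l = code x0 s i j l) ->
  isomorphic_to (size s) f d -> exists s', perm_eq s' s /\ realizes d s'.
Proof.
move=> us fE; rewrite /isomorphic_to -has_find.
case: hasP => // -[r]; rewrite mem_permutations => rp.
rewrite /matches -has_find; case: ifP => // /negbT /hasPn mr _.
have sr : size r = size s by rewrite (perm_size rp) size_iota.
exists [seq nth x0 s i | i <- r]; split.
  rewrite -[X in perm_eq _ X](take_size s) -(map_nth_iota0 x0 (leqnn (size s))).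
  exact: perm_map.
move=> x1 i j l; rewrite size_map sr => is_ js ls ij jl il.
rewrite !(nth_map 0) ?sr //.
have ltr k : k < size s -> nth 0 r k < size s.
  move=> ks; have : nth 0 r k \in r by rewrite mem_nth ?sr.
  by rewrite (perm_mem rp) mem_iota.
have ur : uniq r by rewrite (perm_uniq rp) iota_uniq.
have neq u v : u < size s -> v < size s -> u != v -> nth 0 r u != nth 0 r v.
  by move=> us' vs; rewrite nth_uniq ?sr.
rewrite -middle_code ?neq ?ltr // -(@eq_middle (size s) f) ?neq ?ltr //.
have := mr (i, j, l); rewrite mem_distinct_triples is_ js ls ij jl il.
by move=> /(_ isT); rewrite negbK => /eqP.
Qed.

Definition listed (ds : seq (seq (seq nat))) S := exists s d,
  [/\ uniq s, S = [set x in s], d \in ds & realizes d s].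

Lemma listed_extension ds ds' S x t : x \in S -> #|triangles S| <= t ->
  (forall s d, d \in ds -> #|S| = (size s).+1 ->
    extensions (size s) t (some_isomorphic (size s).+1 ds') d) ->
  listed ds (S :\ x) -> listed ds' S.
Proof.
move=> xS ct ext [s [d [us SE dds ds_s]]].
have xs : x \notin s by move: (setD11 x S); rewrite SE inE => ->.
have uxs : uniq (rcons s x) by rewrite rcons_uniq xs.
have SE' : S = [set y in rcons s x].
  rewrite -(setD1K xS) SE; apply/setP => y.
  by rewrite !inE mem_rcons inE.
have [f gf fE] : exists2 f, some_isomorphic (size s).+1 ds' f &
    forall i j l, i < j -> j < l -> l < size (rcons s x) ->
    f i j l = code x (rcons s x) i j l.
  apply: (@extension_sound x d s x t) => //; first by rewrite -SE'.
  apply: ext => //; rewrite (cardsD1 x) xS SE add1n; congr _.+1.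
  by rewrite cardsE; apply/card_uniqP.
have [d' d'ds' ] := hasP gf; rewrite -(size_rcons s x).
case/(isomorphic_toP uxs fE) => s' [ps' real_s'].
exists s', d'; split=> //; first by rewrite (perm_uniq ps').
by rewrite SE'; apply/setP => y; rewrite !inE (perm_mem ps').
Qed.

Lemma triangles_sub_card S x : #|triangles (S :\ x)| <= #|triangles S|.
Proof. by apply/subset_leq_card/triangles_sub/subsetDl. Qed.

(** A point of any triangle will do, and any point if there is no triangle. This is what lets each
    search start from bases with a smaller bound. *)
Lemma exists_fewer S t : #|triangles S| <= t.+1 -> 0 < #|S| ->
  exists2 x, x \in S & #|triangles (S :\ x)| <= t.
Proof.
move=> ct /card_gt0P[y yS]; have [t0|/exists_degree_gt0[x xS dx]] :=
  posnP #|triangles S|.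
  by exists y => //; apply: leq_trans (triangles_sub_card S y) _; rewrite t0.
by exists x => //; have := card_trianglesD1 S x; lia.
Qed.

Lemma listed_order3 S : #|S| = 3 -> #|triangles S| <= 1 -> listed order3 S.
Proof.
move=> cS ct; have [x xS ctx] : exists2 x, x \in S & #|triangles (S :\ x)| <= 0.
  by apply: exists_fewer; rewrite ?cS.
apply: (@listed_extension [:: tblK2] _ _ x 1) => //.
  by move=> s d; rewrite cS inE => /eqP -> [<-]; apply: extensions2.
have cSx : #|S :\ x| = 2 by have := cardsD1 x S; rewrite xS; lia.
(* On two points [realizes] is vacuous. *)
exists (enum (S :\ x)), tblK2; split; rewrite ?enum_uniq ?inE //.
  by apply/setP => y; rewrite inE mem_enum.
by move=> x0 i j l; rewrite -cardE cSx; lia.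
Qed.

(** Applied with [t = 0], to keep only the triangle-free tables as bases for the next order. *)
Lemma listed_filter ds ds' S t : listed ds S -> #|triangles S| <= t ->
  (forall d, d \in ds -> ntri d #|S| <= t -> d \in ds') -> listed ds' S.
Proof.
move=> [s [d [us SE dds ds_s]]] ct sub; exists s, d; split=> //.
apply: sub => //; move: ct; rewrite SE (card_triangles_realizes us ds_s).
by rewrite cardsE (card_uniqP us).
Qed.

Lemma listed_order4 S : #|S| = 4 -> #|triangles S| <= 1 -> listed order4 S.
Proof.
move=> cS ct; have [x xS ctx] : exists2 x, x \in S & #|triangles (S :\ x)| <= 0.
  by apply: exists_fewer; rewrite ?cS.
have cSx : #|S :\ x| = 3 by have := cardsD1 x S; rewrite xS; lia.
apply: (@listed_extension [:: tblP3] _ _ x 1) => //.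
  by move=> s d; rewrite cS inE => /eqP -> [<-]; apply: extensions3.
apply: (@listed_filter order3 _ _ 0 _ ctx) => [|d]; last first.
  by rewrite cSx /order3 !inE => /orP[] /eqP ->; vm_compute.
by apply: listed_order3 => //; apply: leq_trans ctx _.
Qed.

Lemma listed_order5 S : #|S| = 5 -> #|triangles S| <= 1 -> listed order5 S.
Proof.
move=> cS ct; have [x xS ctx] : exists2 x, x \in S & #|triangles (S :\ x)| <= 0.
  by apply: exists_fewer; rewrite ?cS.
have cSx : #|S :\ x| = 4 by have := cardsD1 x S; rewrite xS; lia.
apply: (@listed_extension [:: tblP4; tblC4] _ _ x 1) => //.
  move=> s d dd; rewrite cS => -[sz]; rewrite -sz.
  exact: (allP extensions4).
apply: (@listed_filter order4 _ _ 0 _ ctx) => [|d]; last first.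
  by rewrite cSx /order4 !inE => /or4P[] /eqP ->; vm_compute.
by apply: listed_order4 => //; apply: leq_trans ctx _.
Qed.

End Realization.

(** * The minimum number of triangles *)

Section LowerBound.
Variable B : betweenness.
Implicit Types (x y z : B) (s : seq B) (A S : {set B}).

Lemma card_set_seq s : uniq s -> #|[set x in s]| = size s.
Proof. by rewrite cardsE => /card_uniqP. Qed.

Lemma card_triangle A : triangle A -> #|A| = 3.
Proof. by case/andP => /eqP. Qed.

Lemma order6_code S : #|S| = 6 -> #|triangles S| <= 2 ->
  exists x0 s f, [/\ uniq s, S = [set x in s], size s = 6, order6_goal f &
    forall i j l, i < j -> j < l -> l < size s -> f i j l = code x0 s i j l].
Proof.
move=> cS ct; have [x xS ctx] : exists2 x, x \in S & #|triangles (S :\ x)| <= 1.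
  by apply: exists_fewer; rewrite ?cS.
have cSx : #|S :\ x| = 5 by have := cardsD1 x S; rewrite xS; lia.
have [s [d [us SE dd ds]]] := listed_order5 cSx ctx.
have xs : x \notin s by move: (setD11 x S); rewrite SE inE => ->.
have ss : size s = 5 by rewrite -card_set_seq // -SE.
have SE' : S = [set y in rcons s x].
  by rewrite -(setD1K xS) SE; apply/setP => y; rewrite !inE mem_rcons inE.
have uxs : uniq (rcons s x) by rewrite rcons_uniq xs.
have [||f gf fE] := @extension_sound _ x d s x 2 order6_goal uxs ds.
- by rewrite -SE'.
- by rewrite ss; apply: (allP extensions5).
by exists x, (rcons s x), f; split; rewrite // size_rcons ss.
Qed.

Lemma card_common x0 s p q : uniq s ->
  p \in triples (size s) -> q \in triples (size s) ->
  #|triple_set x0 s p :&: triple_set x0 s q| = size (common p q).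
Proof.
case: p q => [[i j] l] [[i' j'] l'] us; rewrite !mem_triples.
case/and3P=> ij jl ls /and3P[ij' jl' ls'].
have js := ltn_trans jl ls; have js' := ltn_trans jl' ls'.
have is_ := ltn_trans ij js; have is' := ltn_trans ij' js'.
rewrite -(size_map (nth x0 s)); set c := common _ _.
have lts k : k \in [:: i; j; l] -> k < size s by rewrite !inE => /or3P[] /eqP ->.
have subc : {subset c <= [:: i; j; l]} by apply/mem_subseq/filter_subseq.
rewrite -card_set_seq; last first.
  rewrite map_inj_in_uniq.
    by apply: filter_uniq; rewrite /= !inE; lia.
  by move=> u v /subc /lts us' /subc /lts vs /eqP; rewrite nth_uniq // => /eqP.
apply: eq_card => x; rewrite [RHS]inE; apply/setIP/mapP.
  case; rewrite /triple_set /= !inE -orbA => xl xr.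
  have : exists2 k, k \in [:: i; j; l] & x = nth x0 s k.
    by case/or3P: xl => /eqP ->; [exists i|exists j|exists l];
      rewrite ?inE ?eqxx ?orbT.
  case=> k kl xE; exists k => //; rewrite mem_filter kl andbT.
  by move: xr; rewrite xE -orbA !(nth_uniq x0 (lts k kl)) //= !inE.
case=> k kc xE; move: kc; rewrite mem_filter !inE xE -!orbA => /andP[kr kl].
by split; [case/or3P: kl => /eqP ->|case/or3P: kr => /eqP ->];
  rewrite /triple_set /= ?inE eqxx ?orbT.
Qed.

(** Besides a single triangle, [order6_goal] excludes two triangles sharing exactly one point;
    [spine7] relies on this for seven points. *)
Lemma order6_pair S : #|S| = 6 -> 0 < #|triangles S| <= 2 ->
  exists A A', [/\ A != A', triangles S = [set A; A'], #|A :&: A'| != 1 &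
    #|A :&: A'| = 2 \/ listed order6 S].
Proof.
move=> cS /andP[t0 t2]; have [x0 [s [f [us SE ss gf fE]]]] := order6_code cS t2.
have TE : triangle_triples 6 f =
    [seq p <- triples (size s) | code x0 s p.1.1 p.1.2 p.2 == 3].
  rewrite /triangle_triples ss; apply: eq_in_filter => -[[i j] l].
  by rewrite mem_triples -ss => /and3P[ij jl ls]; rewrite fE.
have trE : triangles S =i [seq triple_set x0 s p | p <- triangle_triples 6 f].
  by move=> A; rewrite TE SE; apply: trianglesE.
have ct : #|triangles S| = size (triangle_triples 6 f).
  by rewrite SE (card_triangles x0) // TE size_filter.
have sub : {subset triangle_triples 6 f <= triples (size s)}.
  by rewrite TE; apply/mem_subseq/filter_subseq.
move: gf t0 sub ct trE; rewrite /order6_goal.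
case: triangle_triples => [|p [|q [|? ?]]] // g t0 sub ct trE.
  by rewrite ct in t0.
have pt : p \in triples (size s) by apply: sub; rewrite inE eqxx.
have qt : q \in triples (size s) by apply: sub; rewrite !inE eqxx orbT.
have trE2 : triangles S = [set triple_set x0 s p; triple_set x0 s q].
  by apply/setP => A; rewrite trE !inE.
exists (triple_set x0 s p), (triple_set x0 s q); split=> //.
- by move: ct; rewrite trE2 cards2; case: (_ != _).
- by rewrite card_common //; move: g; case: eqP => [->|_] //; case: eqP.
move: g; rewrite card_common //; case: eqP => [->|_]; first by left.
case: ifP => // _ /hasP[d dd iso]; right.
have [|s' [ps' real_s']] := @isomorphic_toP _ x0 s f d us fE; first by rewrite ss.
exists s', d; split=> //; first by rewrite (perm_uniq ps').
by rewrite SE; apply/setP => y; rewrite !inE (perm_mem ps').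
Qed.

Lemma order6_neq1 S : #|S| = 6 -> #|triangles S| != 1.
Proof.
move=> cS; apply/eqP => t1; have [|A [A' [AA' E _ _]]] := order6_pair cS.
  by rewrite t1.
by move: t1; rewrite E cards2 AA'.
Qed.

Lemma exists_outside S A : #|A| < #|S| -> exists2 x, x \in S & x \notin A.
Proof.
move=> lt; apply/subsetPn; apply/negP => /subset_leq_card; lia.
Qed.

(** Up to order 5 the truncated difference is at most 1, and order 6 is the search. Beyond that, the
    induction deletes a point chosen so that some triangle is spared. *)
Lemma triangles_ge S : 0 < #|triangles S| -> #|S| - 4 <= #|triangles S|.
Proof.
have [n] := ubnP #|S|; elim: n S => // n IH S Sn t0.
have [S5|S6] := leqP #|S| 5; first by lia.
have [S6'|S7] := leqP #|S| 6.
  by have := @order6_neq1 S; lia.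
have cD x : x \in S -> #|S| = (#|S :\ x|).+1 by rewrite (cardsD1 x S) => ->.
have [A trA] := card_gt0P t0.
have sA : A \subset S /\ #|A| = 3.
  by move: trA; rewrite inE => /andP[/card_triangle].
(* A lone triangle survives the deletion of a point outside it, but then the induction hypothesis
   demands at least two. *)
have [t1|t2] := leqP #|triangles S| 1.
  have [|x xS xA] := @exists_outside S A; first by lia.
  have := IH (S :\ x); have := cD x xS.
  have : 0 < #|triangles (S :\ x)|.
    by apply/card_gt0P; exists A; rewrite trianglesD1 inE trA.
  by have := triangles_sub_card S x; lia.
have /card_gt1P[A1 [A2 [trA1 trA2 A12]]] := t2.
have cA1 : #|A1| = 3 by move: trA1; rewrite inE => /andP[/card_triangle].
have cA2 : #|A2| = 3 by move: trA2; rewrite inE => /andP[/card_triangle].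
(* Deleting [x] destroys [A1] and spares [A2]: the induction hypothesis gives |S| - 5 triangles, and
   [A1] is one more. *)
have [x xA1 xA2] : exists2 x, x \in A1 & x \notin A2.
  apply/subsetPn; apply: contra A12 => sub; rewrite eqEcard sub; lia.
have dx : 0 < degree S x by apply/card_gt0P; exists A1; rewrite !inE in trA1 *; rewrite trA1.
have xS := degree_gt0 dx.
have : 0 < #|triangles (S :\ x)|.
  by apply/card_gt0P; exists A2; rewrite trianglesD1 inE trA2.
have := IH (S :\ x); have := cD x xS; have := card_trianglesD1 S x; lia.
Qed.

Definition spine S y z :=
  y != z /\ forall A, A \in triangles S -> y \in A /\ z \in A.

Lemma degree_le S x : degree S x <= #|triangles S|.
Proof. by rewrite (card_trianglesD1 S x) leq_addr. Qed.

Lemma degree_full S x A : degree S x = #|triangles S| -> A \in triangles S -> x \in A.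
Proof.
move=> dx trA; apply/negPn/negP => xA; have := card_trianglesD1 S x.
have : 0 < #|triangles (S :\ x)|.
  by apply/card_gt0P; exists A; rewrite trianglesD1 inE trA.
lia.
Qed.

Lemma spine6 S : #|S| = 6 -> #|triangles S| = 2 ->
  (exists y z, spine S y z) \/ listed order6 S.
Proof.
move=> cS ct; have [|A [A' [AA' E _ [c2|l]]]] := order6_pair cS; [by rewrite ct| |by right].
left; have /cards2P[y [z [yz AE]]] : #|A :&: A'| == 2 by rewrite c2.
exists y, z; split=> // D; rewrite E => /set2P[] ->; split.
all: have : y \in A :&: A' by rewrite AE !inE eqxx.
all: have : z \in A :&: A' by rewrite AE !inE eqxx orbT.
all: by rewrite !inE => /andP[? ?] /andP[? ?].
Qed.

Lemma spine7 S : 7 <= #|S| -> #|triangles S| = #|S| - 4 ->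
  exists y z, spine S y z.
Proof.
move=> S7 ct; pose F := [set x in S | degree S x == #|triangles S|].
have [F2|F1] := ltnP 1 #|F|.
  have /card_gt1P[y [z [yF zF yz]]] := F2.
  move: yF zF; rewrite !inE => /andP[_ /eqP dy] /andP[_ /eqP dz].
  by exists y, z; split=> // A trA; split; apply: degree_full trA.
(* Some triangle avoids [x], so at least |S| - 5 of the |S| - 4 triangles do. *)
have deg1 x : x \in S -> x \notin F -> degree S x <= 1.
  move=> xS; rewrite inE xS => dx; have := card_trianglesD1 S x.
  have := cardsD1 x S; rewrite xS => cD.
  by have := @triangles_ge (S :\ x); lia.
have FS : F \subset S by apply/subsetP => x; rewrite inE => /andP[].
have sumle : 3 * #|triangles S| <= #|F| * #|triangles S| + (#|S| - #|F|).
  rewrite -sum_degree (bigID (mem F)) /= leq_add //.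
    rewrite -sum_nat_const (eq_bigl (mem F)).
      by apply: leq_sum => x _; apply: degree_le.
    by move=> x; rewrite andb_idl // => /(subsetP FS).
  have <- : #|S :\: F| = #|S| - #|F| by rewrite cardsD (setIidPr FS).
  rewrite -sum1_card (eq_bigl (fun x => x \in S :\: F)); last first.
    by move=> x; rewrite in_setD andbC.
  by apply: leq_sum => x; rewrite in_setD => /andP[xF xS]; apply: deg1.
(* Without common points, 3(n - 4) <= n, which fails for n >= 7. *)
have [F0|F0] := posnP #|F|; first by rewrite F0 in sumle; lia.
have {F0}F1' : #|F| = 1 by lia.
(* One common point gives 2(n - 4) <= n - 1, so n = 7 and there are three triangles, all through
   [p]. *)
have S7' : #|S| = 7 by rewrite F1' in sumle; lia.
rewrite S7' in ct; have /cards1P[p FE] : #|F| == 1 by rewrite F1'.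
have : p \in F by rewrite FE inE.
rewrite inE => /andP[pS /eqP dp].
have [A trA] : exists A, A \in triangles S by apply/card_gt0P; rewrite ct.
have cA : #|A| = 3 by move: trA; rewrite inE => /andP[/card_triangle].
have [x xA xp] : exists2 x, x \in A & x != p.
  have [|x xA xp] := @exists_outside A [set p]; first by rewrite cards1 cA.
  by exists x => //; rewrite inE in xp.
have dx : 0 < degree S x by apply/card_gt0P; exists A; rewrite !inE in trA *; rewrite trA.
have xS := degree_gt0 dx.
have dx1 : degree S x <= 1 by apply: deg1; rewrite // FE inE.
have cSx : #|S :\ x| = 6 by have := cardsD1 x S; rewrite xS; lia.
have ctx : #|triangles (S :\ x)| = 2 by have := card_trianglesD1 S x; lia.
(* The two triangles that avoid [x] share [p], hence also a second point [q] by [order6_pair]; but a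
   point other than [p] lies in at most one triangle. *)
have [|A1 [A2 [A12 E n1 _]]] := order6_pair cSx; first by rewrite ctx.
have trA1 : A1 \in triangles (S :\ x) by rewrite E !inE eqxx.
have trA2 : A2 \in triangles (S :\ x) by rewrite E !inE eqxx orbT.
have sub : triangles (S :\ x) \subset triangles S by apply/triangles_sub/subsetDl.
have {}trA1 := subsetP sub _ trA1; have {}trA2 := subsetP sub _ trA2.
have pI : p \in A1 :&: A2 by rewrite inE !(degree_full dp).
have [q qI qp] : exists2 q, q \in A1 :&: A2 & q != p.
  have [|x' ? xp'] := @exists_outside (A1 :&: A2) [set p].
    rewrite cards1 ltn_neqAle eq_sym n1; apply/card_gt0P; by exists p.
  by exists x' => //; rewrite inE in xp'.
have : 1 < degree S q.
  have /setIP[qA1 qA2] := qI; apply/card_gt1P; exists A1, A2.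
  by split; rewrite // inE ?trA1 ?trA2.
move=> /[dup] /ltnW /degree_gt0 qS.
by rewrite ltnNge deg1 // FE inE.
Qed.

End LowerBound.

(** * Triangle-free structures are paths *)

Section Paths.
Variable B : betweenness.
Implicit Types (x y z w : B) (s : seq B) (A S : {set B}).

Definition ordered s := forall x0 i j l, i < j -> j < l -> l < size s ->
  btw (nth x0 s i) (nth x0 s j) (nth x0 s l).

(* Inserting [y] before the [p]-th point of the ordered sequence [s] gives an
   ordered sequence. *)
Definition inserted s p y := p <= size s /\
  forall x0 i j, i < j -> j < size s ->
    if j < p then btw (nth x0 s i) (nth x0 s j) y
    else if i < p then btw (nth x0 s i) y (nth x0 s j)
    else btw y (nth x0 s i) (nth x0 s j).

Lemma btw_l x y z w : btw x y z -> btw x w y -> btw x w z.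
Proof. by move=> h1 h2; case: (btwP4 h1 h2). Qed.

Lemma btw_r x y z w : btw x y z -> btw x w y -> btw w y z.
Proof. by move=> h1 h2; case: (btwP4 h1 h2). Qed.

Lemma btw_l' x y z w : btw x y z -> btw y w z -> btw x w z.
Proof.
by rewrite btw_sym (btw_sym y) (btw_sym x w) => h1 h2; apply: btw_l h1 h2.
Qed.

Lemma btw_r' x y z w : btw x y z -> btw y w z -> btw x y w.
Proof.
by rewrite btw_sym (btw_sym y) (btw_sym x y w) => h1 h2; apply: btw_r h1 h2.
Qed.

Lemma btw_swapr x y z : btw x y z -> btw x z y -> y = z.
Proof. by rewrite btw_sym (btw_sym x z) => h1 h2; exact: btwP3 h2 h1. Qed.

Lemma nth_insert (T : Type) (x0 y : T) (u v : seq T) i :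
  nth x0 (u ++ y :: v) i = if i == size u then y
    else nth x0 (u ++ v) (if i < size u then i else i.-1).
Proof.
rewrite !nth_cat; case: ltngtP => [iu|ui|->]; rewrite ?iu ?ltnn ?subnn //.
rewrite [i.-1 < _]ltnNge -ltnS prednK ?ui; last by lia.
by have -> : i - size u = (i.-1 - size u).+1 by lia.
Qed.

Lemma ordered_insert u v y : ordered (u ++ v) -> inserted (u ++ v) (size u) y ->
  ordered (u ++ y :: v).
Proof.
move=> os [_ ins] x0 i j l ij jl; rewrite size_cat /= addnS -size_cat => ls.
have lo k : k < size u -> nth x0 (u ++ y :: v) k = nth x0 (u ++ v) k.
  by move=> ku; rewrite nth_insert ku ltn_eqF.
have hi k : size u < k -> nth x0 (u ++ y :: v) k = nth x0 (u ++ v) k.-1.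
  by move=> uk; rewrite nth_insert gtn_eqF // ltnNge ltnW.
have mi : nth x0 (u ++ y :: v) (size u) = y by rewrite nth_insert eqxx.
have ins' := ins x0.
have uv : size u <= size (u ++ v) by rewrite size_cat leq_addr.
case: (ltngtP i (size u)) => [iu|ui|iE]; last 1 first.
- rewrite iE mi !hi; try lia.
  by have := ins' j.-1 l.-1 ltac:(lia) ltac:(lia); do 2?case: ifP => ?; try lia.
- case: (ltngtP j (size u)) => [ju|uj|jE]; last 1 first.
  + rewrite jE mi lo // hi; try lia.
    by have := ins' i l.-1 ltac:(lia) ltac:(lia); do 2?case: ifP => ?; try lia.
  + case: (ltngtP l (size u)) => [lu|ul|lE]; last 1 first.
    * rewrite lE mi !lo //.
      by have := ins' i j ltac:(lia) ltac:(lia); do 2?case: ifP => ?; try lia.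
    * by rewrite !lo //; try lia; apply: os => //; lia.
    * by rewrite (lo i) // (lo j) // (hi l) //; apply: os; lia.
  + by rewrite lo // !hi //; try lia; apply: os; lia.
by rewrite !hi //; try lia; apply: os; lia.
Qed.

Lemma insert_ordered u v y : ordered (u ++ y :: v) ->
  ordered (u ++ v) /\ inserted (u ++ v) (size u) y.
Proof.
move=> os; have nE x0 i : nth x0 (u ++ v) i =
    nth x0 (u ++ y :: v) (if i < size u then i else i.+1).
  case: ltnP => iu; rewrite nth_insert; first by rewrite ltn_eqF // iu.
  by rewrite gtn_eqF // ltnNge ltnW.
have yE x0 : y = nth x0 (u ++ y :: v) (size u) by rewrite nth_insert eqxx.
have sz : size (u ++ y :: v) = (size (u ++ v)).+1 by rewrite !size_cat addnS.
split=> [x0 i j l ij jl ls|].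
  by rewrite !nE; apply: os; rewrite ?sz; do 2?case: ifP; lia.
split=> [|x0 i j ij js]; first by rewrite size_cat leq_addr.
have js' : j.+1 < size (u ++ y :: v) by rewrite sz.
have uv : size u < size (u ++ y :: v) by rewrite sz ltnS size_cat leq_addr.
have os' := os x0; rewrite !nE.
case: (ltnP j (size u)) => ju.
  by rewrite (ltn_trans ij ju) [y in btw _ _ y](yE x0); apply: os'; lia.
case: (ltnP i (size u)) => iu.
  by rewrite [y in btw _ y _](yE x0); apply: os'; lia.
by rewrite [y in btw y _ _](yE x0); apply: os'; lia.
Qed.

Lemma inserted_rev s p y : inserted s p y -> inserted (rev s) (size s - p) y.
Proof.
move=> [ps ins]; split=> [|x0 i j ij]; rewrite size_rev ?leq_subr // => js.
rewrite !nth_rev ?(ltn_trans ij js) //.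
have := ins x0 (size s - j.+1) (size s - i.+1).
have -> : (size s - i.+1 < p) = ~~ (i < size s - p) by lia.
have -> : (size s - j.+1 < p) = ~~ (j < size s - p) by lia.
move=> /(_ ltac:(lia) ltac:(lia)).
case: ltnP => isp /=; case: ltnP => jsp /=; rewrite btw_sym //; lia.
Qed.

Lemma ordered_rev s : ordered s -> ordered (rev s).
Proof.
move=> os x0 i j l ij jl; rewrite size_rev => ls.
rewrite !nth_rev ?(ltn_trans ij (ltn_trans jl ls)) ?(ltn_trans jl ls) //.
by rewrite btw_sym; apply: os; lia.
Qed.

Lemma ordered_btw s x0 i j l : uniq s -> ordered s ->
  i < size s -> j < size s -> l < size s -> i != j -> j != l -> i != l ->
  btw (nth x0 s i) (nth x0 s j) (nth x0 s l) = (i < j < l) || (l < j < i).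
Proof.
move=> us os is_ js ls ij jl il.
wlog lt_il : i l is_ ls ij jl il / i < l.
  move=> h; have [?|?] := ltnP i l; first exact: h.
  by rewrite btw_sym orbC h // 1?eq_sym //; lia.
have [/andP[ij' jl']|out] := boolP (i < j < l); first exact: os.
rewrite /= [RHS](_ : _ = false); last by lia.
apply/negP => h; have [ji|ij'] := ltnP j i.
  have := btwP3 h (os x0 j i l ji lt_il ls).
  by move/eqP; rewrite nth_uniq // (negbTE ij).
have := btw_swapr h (os x0 i l j lt_il ltac:(lia) js).
by move/eqP; rewrite nth_uniq // (negbTE jl).
Qed.

Lemma realizesP4 s : uniq s -> size s = 4 -> ordered s -> realizes tblP4 s.
Proof.
move=> us ss os x0 i j l is_ js ls ij jl il; rewrite ordered_btw //.
move: is_ js ls ij jl il; rewrite ss.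
by move: i j l => [|[|[|[|i]]]] // [|[|[|[|j]]]] // [|[|[|[|l]]]].
Qed.

Lemma realizesP5_ordered s : size s = 5 -> realizes tblP5 s -> ordered s.
Proof.
move=> ss ds x0 i j l ij jl; rewrite ss => ls; rewrite ds ?ss; try lia.
by move: i j l ij jl ls => [|[|[|[|[|i]]]]] // [|[|[|[|[|j]]]]] // [|[|[|[|[|l]]]]].
Qed.

Definition triangle_free S := triangles S = set0.

Lemma triangle_free_sub S S' : S \subset S' -> triangle_free S' -> triangle_free S.
Proof.
by move=> /triangles_sub sub E; apply/eqP; rewrite -subset0 -E.
Qed.

Lemma triangle_free_collinear S x y z : triangle_free S -> x \in S -> y \in S -> z \in S ->
  [|| btw x y z, btw y x z | btw x z y].
Proof.
move=> lS xS yS zS.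
have [->|xy] := eqVneq x y; first by rewrite btwP1.
have [->|yz] := eqVneq y z; first by rewrite btw_xyy.
have [->|xz] := eqVneq x z; first by rewrite btwP1 !orbT.
rewrite -collinear3 //; case: (boolP (collinear _)) => // nc.
have : [set x; y; z] \in triangles S.
  rewrite inE /triangle cards3 xy yz xz nc /=; apply/subsetP => w.
  by rewrite !inE -orbA => /or3P[] /eqP ->.
by rewrite lS inE.
Qed.

(** Four points would not do: in the 4-cycle [a], [b], [d], [x], which is triangle-free, [a] lies
    between [x] and [b] while both [b] and [x] lie between [a] and [d]. The search shows that a
    fifth point rules this out. *)
Lemma insertion4_sound a b c d x : uniq [:: a; b; c; d; x] ->
  ordered [:: a; b; c; d] -> triangle_free [set y in [:: a; b; c; d; x]] ->
  btw a x d -> ~~ btw x a b /\ ~~ btw x a c.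
Proof.
move=> us os lin axd.
have us' : uniq [:: a; b; c; d].
  by move: (us : uniq ([:: a; b; c; d] ++ [:: x])); rewrite cat_uniq => /andP[].
have [|g gg gE] := @extension_sound B a tblP4 [:: a; b; c; d] x 0 _ us
  (realizesP4 us' erefl os) _ insertion4.
  by rewrite lin cards0.
have mE i j l : i < 5 -> j < 5 -> l < 5 -> i != j -> j != l -> i != l ->
    middle g i j l = btw (nth a [:: a; b; c; d; x] i)
      (nth a [:: a; b; c; d; x] j) (nth a [:: a; b; c; d; x] l).
  move=> *; rewrite -(middle_code a us) //; exact: (@eq_middle 5).
by move: gg; rewrite !mE //= axd => /andP[].
Qed.

(** The cases are which of [x] and the two ends of the path lies between the other two. If an end
    does, [x] extends the path there. Otherwise the slot is the first index [p > 0] whose point is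
    not between [N 0] and [x]. *)
Lemma path_insertion s x : uniq (rcons s x) -> 4 <= size s -> ordered s ->
  triangle_free [set y in rcons s x] -> exists p, inserted s p x.
Proof.
move=> us s4 os lin; pose N := nth x s; set m := size s in s4.
have m0 : 0 < m by lia.
have us' : uniq s by move: us; rewrite rcons_uniq => /andP[].
have xs : x \notin s by move: us; rewrite rcons_uniq => /andP[].
have Nos i j l : i < j -> j < l -> l < m -> btw (N i) (N j) (N l).
  exact: os.
have Ns i : i < m -> N i \in s by move=> im; rewrite mem_nth.
have Nx i : i < m -> N i != x.
  by move=> im; apply: contraNneq xs => <-; apply: Ns.
have Nl i j : i < m -> j < m -> [|| btw x (N i) (N j), btw (N i) x (N j)
    | btw x (N j) (N i)].
  move=> im jm; apply: triangle_free_collinear lin _ _ _; rewrite inE mem_rcons inE.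
  - by rewrite eqxx.
  - by rewrite Ns ?orbT.
  by rewrite Ns ?orbT.
(* Comparing [x] with the path points as seen from [N 0] is enough; (P4) passes to arbitrary
   pairs. *)
have build p : p <= m -> (forall j, 0 < j -> j < p -> btw (N 0) (N j) x) ->
    (forall j, 0 < j -> p <= j -> j < m -> btw (N 0) x (N j)) -> 0 < p ->
    inserted s p x.
  move=> pm before after p0; split=> // x0 i j ij jm.
  have is_ := ltn_trans ij jm; rewrite !(set_nth_default x x0) // -/(N i) -/(N j).
  have j0 : 0 < j by lia.
  case: ifP => [jp|/negbT jp].
    have [->|i0] := posnP i; first exact: before.
    by apply: btw_r (before j j0 jp) (Nos _ _ _ i0 ij jm).
  rewrite -leqNgt in jp; case: ifP => [ip|/negbT ip].
    have [->|i0] := posnP i; first exact: after.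
    by apply: btw_r (after j j0 jp jm) (before i i0 ip).
  have i0 : 0 < i by lia.
  by apply: btw_r (Nos _ _ _ i0 ij jm) (after i i0 _ is_); lia.
have lt_last : m.-1 < m by lia.
case/or3P: (Nl 0 m.-1 m0 lt_last) => h.
- exists 0; split=> // x0 i j ij jm; have is_ := ltn_trans ij jm.
  rewrite !(set_nth_default x x0) // -/(N i) -/(N j) /=.
  have x0j k : 0 < k -> k < m -> btw x (N 0) (N k).
    move=> k0 km; have [<- //|kl] := eqVneq m.-1 k.
    apply: btw_r' h _; apply: Nos => //; lia.
  have [->|i0] := posnP i; first by apply: x0j; lia.
  apply: (@btw_l' _ (N 0)); last exact: Nos.
  by apply: x0j; lia.
- pose P j := (j == 0) || btw (N 0) (N j) x.
  have nPl : ~~ P m.-1.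
    rewrite /P negb_or; apply/andP; split; first by lia.
    apply/negP => h'; have := btw_swapr h h'.
    by move/esym/eqP; rewrite (negbTE (Nx _ lt_last)).
  have ex : exists j, ~~ P j by exists m.-1.
  case: (ex_minnP ex) => p nPp minp.
  have pm : p <= m.-1 by apply: minp.
  have beforeP j : j < p -> P j.
    by move=> jp; apply/negPn/negP => /minp; rewrite leqNgt jp.
  have p0 : 0 < p by case: (p) nPp.
  exists p; apply: build => // [|j j0 jp|j j0 pj jm]; first by lia.
    by have := beforeP j jp; rewrite /P; case: eqP => // jE; lia.
  have [-> //|jl] := eqVneq j m.-1.
  have jlt : j < m.-1 by lia.
  have nPj : ~~ btw (N 0) (N j) x.
    apply/negP => hj; move: nPp; rewrite /P negb_or => /andP[_ /negP]; apply.
    have [-> //|pj'] := eqVneq p j.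
    by apply: btw_l hj _; apply: Nos => //; lia.
  (* Past the cut, [N 0] might still lie between [x] and an inner point [N j]. The five-point lemma
     excludes it once a second inner point is at hand: 1 is paired with 2 and any other [j] with 1,
     which uses [4 <= size s]. *)
  have key i k : 0 < i -> i < k -> k < m.-1 ->
      ~~ btw x (N 0) (N i) /\ ~~ btw x (N 0) (N k).
    move=> i0 ik kl; have km : k < m by lia.
    have im : i < m by lia.
    apply: (@insertion4_sound _ _ _ (N m.-1)) => //.
    + rewrite /= !inE !negb_or !Nx // !nth_uniq //=; lia.
    + move=> x0 [|[|[|[|a]]]] [|[|[|[|b]]]] [|[|[|[|c]]]] //= _ _ _;
        apply: Nos; lia.
    apply: triangle_free_sub lin; apply/subsetP => y; rewrite !inE mem_rcons inE.
    by case/or4P=> [| | |/orP[]] /eqP ->; rewrite ?eqxx ?Ns ?orbT.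
  have nx : ~~ btw x (N 0) (N j).
    have [j1|j1] := eqVneq j 1.
      by have [] := key j j.+1 j0 (leqnn _) ltac:(lia).
    by have [] := key 1 j isT ltac:(lia) jlt.
  have := Nl 0 j m0 jm; rewrite (negbTE nx) btw_sym [btw x _ _]btw_sym.
  by rewrite (negbTE nPj) orbF /= btw_sym.
exists m; apply: build => // [j j0 jm|j _ mj]; last by lia.
rewrite btw_sym in h.
have [-> //|jl] := eqVneq j m.-1.
by apply: btw_l h _; apply: Nos => //; lia.
Qed.

(** The induction starts at 5, where [tblP5] is the only triangle-free table; at 4 the 4-cycle is a
    second one. *)
Lemma triangle_free_path S : 5 <= #|S| -> triangle_free S ->
  exists s, [/\ uniq s, S = [set x in s] & ordered s].
Proof.
have [n] := ubnP #|S|; elim: n S => // n IH S Sn S5 lin.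
have [S5'|S6] := eqVneq #|S| 5.
  have [|s [d [us SE dd ds]]] := @listed_order5 _ S S5'; first by rewrite lin cards0.
  have ss : size s = 5 by rewrite -card_set_seq // -SE.
  exists s; split=> //; apply: realizesP5_ordered => //.
  have := card_triangles_realizes us ds; rewrite -SE lin cards0 ss.
  by move: dd ds; rewrite /order5 !inE => /or4P[] /eqP ->.
have [x xS] : exists x, x \in S by apply/card_gt0P; lia.
have cD : #|S| = (#|S :\ x|).+1 by rewrite (cardsD1 x S) xS.
have [||| s [us SE os]] := IH (S :\ x); try lia.
  by apply: triangle_free_sub lin; apply: subsetDl.
have xs : x \notin s by move: (setD11 x S); rewrite SE inE => ->.
have SE' : S = [set y in rcons s x].
  by rewrite -(setD1K xS) SE; apply/setP => y; rewrite !inE mem_rcons inE.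
have uxs : uniq (rcons s x) by rewrite rcons_uniq xs.
have ss : size s = #|S :\ x| by rewrite SE card_set_seq.
have s4 : 4 <= size s by lia.
have [|p ins] := path_insertion uxs s4 os; first by rewrite -SE'.
have [ps _] := ins.
have pt : perm_eq (take p s ++ x :: drop p s) (x :: s).
  by rewrite perm_catC /= perm_cons perm_catC cat_take_drop.
exists (take p s ++ x :: drop p s); split.
- by rewrite (perm_uniq pt) /= xs.
- by rewrite -(setD1K xS) SE; apply/setP => y; rewrite !inE (perm_mem pt) inE.
apply: ordered_insert; rewrite cat_take_drop // size_take.
by move: ps; rewrite leq_eqVlt => /orP[/eqP <-|->]; rewrite ?ltnn.
Qed.

End Paths.

(** * Two points common to all triangles *)

Section Shapes.
Variable B : betweenness.
Implicit Types (x y z w : B) (s : seq B) (A S : {set B}).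

Definition aligned y z w := [|| btw y z w, btw z y w | btw y w z].

Lemma alignedC y z w : aligned y z w = aligned z y w.
Proof. by rewrite /aligned orbCA (btw_sym y w). Qed.

Lemma triangle_aligned y z w : y != z -> y != w -> z != w ->
  triangle [set y; z; w] = ~~ aligned y z w.
Proof. by move=> yz yw zw; rewrite /triangle cards3 yz zw yw collinear3. Qed.

(** Each triangle is {y, z, w} with [w] in [s], and such a set is a triangle unless [w] is aligned.
    The identity serves both ways: a co-size of n - 4 leaves two aligned points, and two aligned
    points give the models co-size n - 4. *)
Lemma count_aligned s y z : uniq (y :: z :: s) ->
  (forall x, x \in y :: z :: s) -> spine setT y z ->
  #|triangles [set: B]| + count (aligned y z) s = size s.
Proof.
move=> us all_s [yz sp].
have /and3P[+ zs us'] := us; rewrite inE negb_or => /andP[_ ys].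
pose W := [seq w <- s | ~~ aligned y z w].
have WE w : w \in W -> [/\ y != w, z != w, w \in s & ~~ aligned y z w].
  rewrite mem_filter => /andP[nw ws]; split=> //.
    by apply: contraNneq ys => ->.
  by apply: contraNneq zs => ->.
have tE : triangles [set: B] = [set [set y; z; w] | w in W].
  apply/setP => A; apply/idP/imsetP.
    move=> trA; have [yA zA] := sp A trA; move: trA; rewrite inE subsetT andbT.
    move=> trA; have [|w wA] := @exists_outside B A [set y; z].
      by rewrite cards2 yz (card_triangle trA).
    rewrite !inE negb_or => /andP[wy wz].
    have AE : A = [set y; z; w].
      apply/eqP; rewrite eq_sym eqEcard (card_triangle trA).
      have /eqP -> : #|[set y; z; w]| == 3.
        by rewrite cards3 yz (eq_sym z) (eq_sym y) wy wz.
      rewrite leqnn andbT; apply/subsetP => t.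
      by rewrite !inE -orbA => /or3P[] /eqP ->.
    exists w => //; rewrite mem_filter -triangle_aligned // 1?eq_sym // -AE trA.
    by have := all_s w; rewrite !inE (negbTE wy) (negbTE wz).
  case=> w /WE[yw zw _ nw] ->.
  by rewrite inE subsetT andbT triangle_aligned.
have cW : #|triangles [set: B]| = size W.
  rewrite tE card_in_imset.
    by apply/card_uniqP; rewrite filter_uniq.
  move=> w w' /WE[yw zw _ _] _ E.
  have : w \in [set y; z; w'] by rewrite -E !inE eqxx orbT.
  by rewrite !inE (eq_sym w y) (negbTE yw) (eq_sym w z) (negbTE zw) => /eqP.
by rewrite cW size_filter addnC count_predC.
Qed.

(** * Path points collinear with two inserted points *)

Section Positions.
Variables (x0 : B) (s : seq B) (y z : B).
Hypothesis us : uniq (y :: z :: s).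
Local Notation m := (size s).
Local Notation N := (nth x0 s).
Local Notation al := (aligned y z).

Lemma uniq_path : uniq s. Proof. by case/and3P: us. Qed.

Lemma N_neq i j : i < m -> j < m -> i != j -> N i != N j.
Proof. by move=> im jm ij; rewrite nth_uniq // uniq_path. Qed.

Lemma no_swap x i j : i < m -> j < m -> i != j ->
  btw x (N i) (N j) -> btw x (N j) (N i) -> False.
Proof.
move=> im jm ij h1 h2; have := btw_swapr h1 h2.
by apply/eqP/N_neq.
Qed.

Lemma no_swapl x i j : i < m -> j < m -> i != j ->
  btw (N i) (N j) x -> btw (N j) (N i) x -> False.
Proof.
by move=> im jm ij h1 h2; have := btwP3 h1 h2; apply/eqP/N_neq.
Qed.

(** A path point next to [y] serves as a hinge: (P4) combines its relations to [y] and to [z]. It is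
    [N p] for points outside the stretch from [y] to [z], and [N p.-1], which needs [0 < p], for
    those inside. *)
Lemma aligned_lt p q : inserted s p y -> inserted s q z -> p < q -> 0 < p ->
  forall k, k < m -> al (N k).
Proof.
clear us; move=> [pm yp] [qm zq] pq p0 k km; have {}yp := yp x0; have {}zq := zq x0.
have pm' : p < m by lia.
rewrite /aligned; have [kp|pk] := ltnP k p.
  have := yp k p kp pm'; rewrite ltnn kp => h1.
  have := zq k p kp pm'; rewrite pq => h2.
  by rewrite (btw_sym z) (btw_l h2 h1) orbT.
have [kq|qk] := ltnP k q.
  have p1 : p.-1 < k by lia.
  have := yp _ _ p1 km; rewrite ltnNge pk /= ltn_predL p0 => h1.
  have := zq _ _ p1 km; rewrite kq => h2.
  by rewrite (btw_r h2 h1) !orbT.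
have pk' : p < k by lia.
have := yp _ _ pk' km; rewrite ltnNge pk /= ltnn => h1.
have := zq _ _ pk' km; rewrite ltnNge qk /= pq => h2.
rewrite btw_sym in h1; rewrite btw_sym in h2.
by rewrite (btw_sym y) (btw_l h1 h2).
Qed.

(** Any other alignment would put two path points in contradictory orders, or put [N 0] between [y]
    and [z]; in the latter case all path points would be aligned. *)
Lemma aligned_ends : inserted s 0 y -> inserted s m z -> 2 <= m ->
  ~~ all al s -> forall j, j < m -> al (N j) ->
  (j = 0 /\ btw (N 0) y z) \/ (j = m.-1 /\ btw y z (N m.-1)).
Proof.
move=> [_ yp] [_ zq] m2 nall j jm; have {}yp := yp x0; have {}zq := zq x0.
have yN i k : i < k -> k < m -> btw y (N i) (N k) by move=> /yp h /h.
have zN i k : i < k -> k < m -> btw (N i) (N k) z.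
  by move=> ik km; have := zq i k ik km; rewrite km.
case/or3P=> h.
- move: jm h; have [->|jl] := eqVneq j m.-1; [by right | move=> jm h].
  have jl' : j < m.-1 by lia.
  have h1 := btw_r (yN _ _ jl' ltac:(lia)) h.
  have := zN _ _ jl' ltac:(lia); rewrite btw_sym => h2.
  by case: (no_swap _ _ _ h1 h2); lia.
- move: jm h; have [->|j0] := posnP j => jm h; first by left; rewrite btw_sym.
  have h1 : btw z (N j) (N 0) by rewrite btw_sym; apply: zN.
  have h2 := btw_r h1 h; have h3 := yN _ _ j0 jm.
  by case: (no_swap _ _ _ h2 h3); lia.
have h0 : btw y (N 0) z.
  have [<- //|j0] := posnP j.
  by apply: btw_l h _; apply: yN.
case/negP: nall; apply/allP => w /(nthP x0)[k km <-].
rewrite /aligned; have [->|k0] := posnP k; first by rewrite h0 !orbT.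
by rewrite (btw_l' h0 (zN _ _ k0 km)) !orbT.
Qed.

(** Were [z] between [y] and a path point, or conversely, all path points would be aligned ([side]).
    So an aligned point lies between [y] and [z]. If it were away from the slot [p], it and its
    neighbour towards the slot would appear in both orders. *)
Lemma aligned_twin p : inserted s p y -> inserted s p z ->
  ~~ all al s -> forall j, j < m -> al (N j) ->
  btw y (N j) z /\ (j = p \/ j.+1 = p).
Proof.
move=> yp zp nall j jm; have side y' z' : inserted s p y' -> inserted s p z' ->
    btw y' z' (N j) -> all (aligned y' z') s.
  move=> [_ {}yp] [_ {}zp] yzj; have {}yp := yp x0; have {}zp := zp x0.
  have jzy : btw (N j) z' y' by rewrite btw_sym.
  apply/allP => w /(nthP x0)[k km <-]; rewrite /aligned.
  have [jp|pj] := ltnP j p.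
    case: (ltngtP k j) => [kj|jk|->]; last by rewrite yzj.
      have := yp _ _ kj jm; rewrite jp btw_sym => h.
      by rewrite (btw_l h yzj).
    have h1 := yp _ _ jk km; have h2 := zp _ _ jk km.
    move: h1 h2; rewrite jp; case: ifP => _ h1 h2.
      by rewrite btw_sym (btw_r jzy h2).
    by rewrite (btw_r h1 jzy) orbT.
  case: (ltngtP k j) => [kj|jk|->]; last by rewrite yzj.
    have h1 := yp _ _ kj jm; have h2 := zp _ _ kj jm.
    move: h1 h2; rewrite ltnNge pj /=; case: ifP => _ h1 h2.
      by rewrite btw_sym in h1; rewrite (btw_r h1 jzy) orbT.
    by rewrite btw_sym in h2; rewrite btw_sym (btw_r jzy h2).
  have := yp _ _ jk km; rewrite !ltnNge pj (leq_trans pj (ltnW jk)) /= => h.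
  by rewrite (btw_l h yzj).
case/or3P=> h.
- by rewrite (side y z) in nall.
- case/negP: nall; have /allP sd := side z y zp yp h.
  by apply/allP => w ws; rewrite alignedC sd.
split=> //; case: yp zp => [pm {}yp] [_ {}zp].
have {}yp := yp x0; have {}zp := zp x0.
have [jp|pj] := ltnP j.+1 p.
  have j1m : j.+1 < m by lia.
  have := yp _ _ (ltnSn j) j1m; have := zp _ _ (ltnSn j) j1m.
  rewrite jp [btw _ _ y]btw_sym => h1 h2.
  by case: (no_swapl _ _ _ h1 (btw_r h h2)); lia.
have [pj'|jp'] := ltnP p j; last by lia.
have := yp _ _ pj' jm; have := zp _ _ pj' jm.
rewrite ltnNge (ltnW pj') /= ltnn btw_sym => h1 h2.
by case: (no_swapl _ _ _ h1 (btw_r h h2)); lia.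
Qed.

Lemma two_aligned i1 i2 : count al s = 2 ->
  (forall j, j < m -> al (N j) -> j = i1 \/ j = i2) ->
  [/\ i1 < m, i2 < m, al (N i1) & al (N i2)].
Proof.
move=> c2 only; pose I := [seq j <- iota 0 m | al (N j)].
have cI : size I = 2.
  rewrite -c2 -size_filter -[in RHS](mkseq_nth x0 s) /mkseq filter_map size_map.
  by [].
have sub : {subset I <= [:: i1; i2]}.
  move=> j; rewrite mem_filter mem_iota => /andP[a /only] /(_ a).
  by rewrite !inE => -[] ->; rewrite eqxx ?orbT.
have uI : uniq I by rewrite filter_uniq ?iota_uniq.
have [|_ IE] := uniq_min_size uI sub; first by rewrite cI.
have : i1 \in I by rewrite IE !inE eqxx.
have : i2 \in I by rewrite IE !inE eqxx orbT.
by rewrite !mem_filter !mem_iota !add0n => /andP[a2 i2m] /andP[a1 i1m].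
Qed.

End Positions.

(* The shape of [R4]: y and z both lie between two consecutive path points. *)
Definition twin_shape s y z p := [/\ 0 < p < size s, inserted s p y, inserted s p z
  & forall x0, btw y (nth x0 s p.-1) z /\ btw y (nth x0 s p) z].

(* The shape of [S4]: y and z extend the path at its two ends. *)
Definition end_shape s y z := [/\ inserted s 0 y, inserted s (size s) z &
  forall x0, btw (nth x0 s 0) y z /\ btw y z (nth x0 s (size s).-1)].

Lemma shape_le s y z p q : uniq (y :: z :: s) -> 3 <= size s ->
  count (aligned y z) s = 2 -> inserted s p y -> inserted s q z -> p <= q ->
  twin_shape s y z p \/ end_shape s y z.
Proof.
move=> us m3 c2 yp zq pq.
have nall : ~~ all (aligned y z) s by rewrite all_count c2; lia.
have [pm _] := yp; have [qm _] := zq.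
have [qE|pq'] := eqVneq p q.
  subst q; left.
  have only x0 j : j < size s -> aligned y z (nth x0 s j) -> j = p.-1 \/ j = p.
    by move=> jm a; have [_ []] := aligned_twin us yp zq nall jm a; lia.
  have [p1m pm' a1 a2] := two_aligned c2 (only y).
  have p0 : 0 < p.
    rewrite lt0n; apply/eqP => p0; move: (only y); rewrite p0 => only'.
    (* At [p = 0] also [p.-1] is 0, which leaves one candidate; the out-of-range index [size s] pads
       the list so that [two_aligned] refutes it. *)
    have only0 j : j < size s -> aligned y z (nth y s j) -> j = 0 \/ j = size s.
      by move=> jm a; case: (only' j jm a) => ->; left.
    by have [_] := two_aligned c2 only0; rewrite ltnn.
  split=> //; first by rewrite p0.
  move=> x0; have := aligned_twin us yp zq nall p1m a1.
  have := aligned_twin us yp zq nall pm' a2.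
  by rewrite !(set_nth_default y x0) // => -[-> _] [-> _].
right; have lt_pq : p < q by rewrite ltn_neqAle pq'.
have p0 : p = 0.
  apply/eqP; rewrite -leqn0 leqNgt; apply/negP => p0.
  case/negP: nall; apply/allP => w /(nthP y)[k km <-].
  exact: (aligned_lt y yp zq lt_pq p0).
(* Reversing the path exchanges the roles of [y] and [z], so [aligned_lt] applies again. *)
have qE : q = size s.
  apply/eqP; rewrite eqn_leq qm leqNgt; apply/negP => q_lt.
  case/negP: nall; apply/allP => w; rewrite -mem_rev => /(nthP y)[k km <-].
  rewrite alignedC; apply: (aligned_lt y (inserted_rev zq) (inserted_rev yp)) => //.
  - by lia.
  by lia.
subst p q; have only x0 j : j < size s -> aligned y z (nth x0 s j) ->
    j = 0 \/ j = (size s).-1.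
  by move=> jm a; case: (aligned_ends us yp zq _ nall jm a) => [|[]|[]]; lia.
split=> // x0; have [m0 m1 a0 a1] := two_aligned c2 (only x0).
split.
  by case: (aligned_ends us yp zq _ nall m0 a0) => [|[]|[]] //; lia.
by case: (aligned_ends us yp zq _ nall m1 a1) => [|[]|[]] //; lia.
Qed.

(** Both points must be placed in one and the same path: [y] is removed from the path on all points
    but [z], and [z] is then inserted into what remains. Six points are required so that the first
    path has five. Exchanging [y] and [z] provides the order of positions that [shape_le]
    expects. *)
Lemma spine_shape y z : 6 <= #|B| -> cosize B = #|B| - 4 -> spine [set: B] y z ->
  exists s y' z', [/\ uniq (y' :: z' :: s), forall x, x \in y' :: z' :: s,
    ordered s & (exists p, twin_shape s y' z' p) \/ end_shape s y' z'].
Proof.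
move=> B6 ct [yz sp]; rewrite cosizeE in ct.
have linD x : (forall A, A \in triangles [set: B] -> x \in A) -> triangle_free ([set: B] :\ x).
  move=> xA; apply/setP => A; rewrite trianglesD1 !inE; apply/negP.
  by case/andP=> /andP[trA _]; rewrite xA // inE trA subsetT.
have cD x : #|[set: B] :\ x| = #|B|.-1.
  by have := cardsD1 x [set: B]; rewrite inE cardsT; lia.
have [||t [ut tE ot]] := @triangle_free_path B ([set: B] :\ z).
- by rewrite cD; lia.
- by apply: linD => A /sp[].
have yt : y \in t by have := yz; rewrite -in_set1 -in_setC -setTD tE inE.
have zt : z \notin t by have := setD11 z [set: B]; rewrite tE inE => ->.
have st : size t = #|B|.-1 by rewrite -(cD z) tE card_set_seq.
case/splitPr: yt ut tE ot zt st => u v ut tE ot zt st.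
have [os yp] := insert_ordered ot; set s := u ++ v in os yp.
have pt : perm_eq (u ++ y :: v) (y :: s).
  by rewrite -cat1s perm_catCA.
have us : uniq (y :: z :: s).
  move: ut zt; rewrite (perm_uniq pt) (perm_mem pt) /= !inE !negb_or yz /=.
  by case/andP=> -> -> /andP[_ ->].
have all_s x : x \in y :: z :: s.
  have := in_setT x; rewrite -(setD1K (in_setT z)) tE !inE (perm_mem pt) inE.
  by rewrite orbCA.
have ss : size s = #|B| - 2.
  by move: st; rewrite (perm_size pt) /=; lia.
have linz : triangle_free [set x in rcons s z].
  apply: triangle_free_sub (linD y _); last by move=> A /sp[].
  apply/subsetP => x; rewrite !inE mem_rcons inE andbT.
  move: us => /= /andP[]; rewrite inE negb_or => /andP[_ ys] _.
  by apply: contraTneq => ->; rewrite negb_or yz.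
have uz : uniq (rcons s z) by rewrite rcons_uniq; case/andP: us.
have s4 : 4 <= size s by lia.
have [q zq] := path_insertion uz s4 os linz.
have c2 : count (aligned y z) s = 2.
  by have := count_aligned us all_s (conj yz sp); rewrite ct ss; lia.
have m3 : 3 <= size s by lia.
have [pq|qp] := leqP (size u) q.
  exists s, y, z; split=> //.
  by case: (shape_le us m3 c2 yp zq pq); [left; exists (size u)|right].
have us' : uniq (z :: y :: s).
  by move: us; rewrite /= !inE !negb_or (eq_sym z) => /and3P[/andP[-> ->] -> ->].
exists s, z, y; split=> //.
  by move=> x; have := all_s x; rewrite !inE orbCA.
have c2' : count (aligned z y) s = 2.
  by rewrite -c2; apply: eq_count => x; rewrite alignedC.
by case: (shape_le us' m3 c2' zq yp (ltnW qp)); [left; exists q|right].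
Qed.

End Shapes.

(** * Isomorphisms and distances *)

Section Isomorphisms.
Implicit Types (B C : betweenness).

Lemma btw_degenerate B (x y z : B) : ~~ [&& x != y, y != z & x != z] ->
  btw x y z = (x == y) || (y == z).
Proof.
have [->|xy] := eqVneq x y; first by rewrite btwP1.
have [->|yz] := eqVneq y z; first by rewrite btw_xyy.
have [->|//] := eqVneq x z => _; apply/negP => /btw_xyx.
by apply/eqP; rewrite eq_sym.
Qed.

Lemma isomorphic_distinct B C (f : B -> C) : bijective f ->
  (forall x y z, x != y -> y != z -> x != z ->
     btw (f x) (f y) (f z) = btw x y z) -> isomorphic B C.
Proof.
move=> bf h; exists f => // x y z.
have fE a b : (f a == f b) = (a == b) by apply: inj_eq (bij_inj bf) _ _.
have [/and3P[xy yz xz]|deg] := boolP [&& x != y, y != z & x != z]; first exact: h.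
by rewrite !btw_degenerate ?fE.
Qed.

Lemma isomorphic_sym B C : isomorphic B C -> isomorphic C B.
Proof.
case=> f [g fK gK] h; exists g; first by exists f.
by move=> x y z; rewrite -h !gK.
Qed.

Lemma isomorphic_card B C : isomorphic B C -> #|B| = #|C|.
Proof. by case=> f bf _; apply: bij_eq_card bf. Qed.

Lemma triangleP B (A : {set B}) : triangle A ->
  exists x y z, [/\ A = [set x; y; z], x != y, y != z & x != z].
Proof.
move=> trA; have cA := card_triangle trA.
have [x0 _] : exists x, x \in A by apply/card_gt0P; rewrite cA.
have [|[[i j] l] _ AE] := @triple_setP B x0 (enum [set: B]) (enum_uniq _) A cA.
  by apply/subsetP => x _; rewrite inE mem_enum inE.
move: cA; rewrite AE => /eqP; rewrite cards3 => /and3P[xy yz xz].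
by eexists _, _, _; split.
Qed.

Lemma imset3 (T T' : finType) (f : T -> T') x y z :
  f @: [set x; y; z] = [set f x; f y; f z].
Proof. by rewrite !imsetU !imset_set1. Qed.

Lemma isomorphic_cosize B C : isomorphic B C -> cosize B = cosize C.
Proof.
have le B' C' : isomorphic B' C' -> cosize B' <= cosize C'.
  case=> f bf h; rewrite !cosizeE.
  have inj := imset_inj (bij_inj bf).
  rewrite -(card_imset _ inj); apply/subset_leq_card/subsetP => _ /imsetP[A + ->].
  rewrite !inE !subsetT !andbT => trA.
  have [x [y [z [AE xy yz xz]]]] := triangleP trA.
  move: trA; rewrite AE imset3 !triangle3 ?(inj_eq (bij_inj bf)) //.
  by rewrite /label !h.
by move=> iso; apply/eqP; rewrite eqn_leq !le //; apply: isomorphic_sym.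
Qed.

(* Equality of the co-sizes forces triangles to be mapped to triangles. *)
Lemma isomorphic_forward B C (f : C -> B) : bijective f ->
  (forall x y z, x != y -> y != z -> x != z -> btw x y z ->
     btw (f x) (f y) (f z)) -> cosize B = cosize C -> isomorphic B C.
Proof.
move=> bf fwd co; have inj := bij_inj bf.
apply/isomorphic_sym/(isomorphic_distinct bf) => x y z xy yz xz.
apply/idP/idP => [h|]; last exact: fwd.
have [g fK gK] := bf.
pose pre (A : {set B}) := f @^-1: A.
have sub : pre @: triangles [set: B] \subset triangles [set: C].
  apply/subsetP => _ /imsetP[A + ->]; rewrite !inE !subsetT !andbT => trA.
  have [a [b [c [AE ab bc ac]]]] := triangleP trA.
  have -> : pre A = [set g a; g b; g c].
    by apply/setP => t; rewrite !inE AE !inE !(can2_eq fK gK).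
  have injg := can_inj gK.
  move: trA; rewrite AE /triangle !cards3 !(inj_eq injg) ab bc ac /=.
  apply: contra; rewrite !collinear3 ?(inj_eq injg) //.
  have ba : b != a by rewrite eq_sym.
  have cb : c != b by rewrite eq_sym.
  case/or3P=> h'; apply/or3P; [apply: Or31|apply: Or32|apply: Or33];
    by have := fwd _ _ _ _ _ _ h'; rewrite !gK !(inj_eq injg); apply.
(* Taking preimages is injective, so by equality of the co-sizes every triangle of [C] is the
   preimage of one of [B]. *)
have eqT : pre @: triangles [set: B] = triangles [set: C].
  apply/eqP; rewrite eqEcard sub /= card_imset -?cosizeE ?co //.
  move=> A A' E; apply/setP => t.
  by have := congr1 (fun D : {set C} => g t \in D) E; rewrite !inE gK.
have nt : ~~ triangle [set x; y; z].
  apply/negP => tr; have : [set x; y; z] \in triangles [set: C].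
    by rewrite inE tr subsetT.
  rewrite -eqT => /imsetP[A]; rewrite inE subsetT andbT => trA E.
  have AE : A = [set f x; f y; f z].
    by rewrite -imset3 E; apply/setP => t; rewrite -(gK t) mem_imset // inE gK.
  move: trA; rewrite AE triangle3 ?(inj_eq inj) // /label h; by [].
move: nt; rewrite /triangle cards3 xy yz xz /= negbK collinear3 //.
have yx : y != x by rewrite eq_sym.
have zy : z != y by rewrite eq_sym.
(* The triple is collinear in [C]; a middle point other than [y] would be carried over by [f] and
   contradict [h]. *)
case/or3P=> // h'.
  have /inj E := btwP3 h (fwd _ _ _ yx xz yz h').
  by rewrite E eqxx in xy.
have /inj E := btw_swapr h (fwd _ _ _ xz zy xy h').
by rewrite E eqxx in yz.
Qed.

Lemma isomorphic_realizes B C d (s : seq B) (t : seq C) :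
  uniq s -> (forall x, x \in s) -> uniq t -> (forall x, x \in t) ->
  realizes d s -> realizes d t -> size s = size t -> isomorphic B C.
Proof.
move=> us sB ut tC ds dt st; have /card_gt0P[b0 _] := pt_gt0 B.
have /card_gt0P[c0 _] := pt_gt0 C.
have ib x : index x s < size s by rewrite index_mem.
have jb x : index x t < size t by rewrite index_mem.
apply: (@isomorphic_distinct _ _ (fun x => nth c0 t (index x s))).
  exists (fun y => nth b0 s (index y t)) => [x|y].
    by rewrite index_uniq -?st ?nth_index.
  by rewrite index_uniq ?st ?nth_index.
move=> x y z xy yz xz.
have neq u v : u != v -> index u s != index v s.
  by apply: contraNneq => E; rewrite -(nth_index b0 (sB u)) E nth_index.
rewrite dt -?st ?neq // -(@ds b0) ?neq //.
by rewrite !nth_index.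
Qed.

End Isomorphisms.

(** * Graph distances from potentials *)

Section Models.
Import Order.TTheory GRing.Theory Num.Theory.
Local Open Scope ring_scope.
Variables (R : realType) (W : wgraph R).
Implicit Types (u v w : W).

(* A potential that drops by at most the weight along every edge, and by exactly
   the weight along some edge towards [v], is the distance to [v]. *)
Lemma dist_potential (D : W -> W -> nat) :
  (forall v, D v v = 0%N) ->
  (forall u w v, edge u w -> (D u v)%:R <= weight u w + (D w v)%:R) ->
  (forall u v, u != v -> exists2 w, edge u w &
     (D u v)%:R = weight u w + (D w v)%:R) ->
  forall u v, dist u v = (D u v)%:R.
Proof.
move=> D0 lb ub u v; apply/eqP; rewrite eq_le; apply/andP; split; last first.
  apply: dist_ge => p /and3P[+ /eqP + _].
  elim: p u => [|w p IH] u /=; first by move=> _ ->; rewrite D0.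
  case/andP=> euw /IH{}IH /IH{}IH; apply: le_trans (lb _ w _ euw) _.
  by rewrite lerD2l.
have [p pp [<- <-]] : exists2 p, path (@edge R W) u p &
    last u p = v /\ walk_length u p = (D u v)%:R.
  have [n] := ubnP (D u v); elim: n u => // n IH u Dn.
  have [->|uv] := eqVneq u v; first by exists [::]; rewrite //= D0.
  have [w euw E] := ub u v uv.
  have [|p pp [lp wp]] := IH w.
    have : (D w v)%:R < (D u v)%:R :> R.
      by rewrite E ltrDr weight_gt0.
    by rewrite ltr_nat; lia.
  by exists (w :: p); rewrite /= ?euw // lp wp E.
exact: dist_le_walk.
Qed.

Lemma induced_btw (D : W -> W -> nat) : (forall u v, dist u v = (D u v)%:R) ->
  forall u v w, @btw (induced W) u v w = (D u w == D u v + D v w)%N.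
Proof.
by move=> E u v w; rewrite /= /metric_btw !E -natrD eqr_nat.
Qed.

(** The hypotheses of [dist_potential] in a form that computation settles: off the diagonal some
    edge attains the entry, and no edge undercuts it. Matching on [t] only supplies a default
    vertex. *)
Definition distance_table (t : seq W) (wt : W -> W -> nat) (d : seq (seq nat)) :=
  let k := size t in
  all (fun i => all (fun j =>
    (if i == j then entry d i j == 0%N else
      has (fun l => if t is u0 :: _ then
          edge (nth u0 t i) (nth u0 t l) &&
          (entry d i j == wt (nth u0 t i) (nth u0 t l) + entry d l j)%N
        else false) (iota 0 k)) &&
    all (fun l => if t is u0 :: _ then
          edge (nth u0 t i) (nth u0 t l) ==>
          (entry d i j <= wt (nth u0 t i) (nth u0 t l) + entry d l j)%N
        else false) (iota 0 k)) (iota 0 k)) (iota 0 k).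

Lemma induced_realizes (t : seq W) wt d : uniq t -> (forall u, u \in t) ->
  (forall u v, edge u v -> weight u v = (wt u v)%:R) ->
  distance_table t wt d -> @realizes (induced W) d t.
Proof.
move=> ut tW wtE; case tE : t => [|u0 t'] tab.
  by move=> ? i; rewrite ltn0.
rewrite -tE in tab *.
have ti u : (index u t < size t)%N by rewrite index_mem.
have tn u : nth u0 t (index u t) = u by rewrite nth_index.
have ii u : index u t \in iota 0 (size t) by rewrite mem_iota add0n ti.
have tabP u v := allP (allP tab _ (ii u)) _ (ii v).
pose D u v := entry d (index u t) (index v t).
have inj u v : index u t = index v t -> u = v.
  by move=> E; rewrite -(tn u) E.
have dE u v : dist u v = (D u v)%:R.
  apply: (@dist_potential D).
  - by move=> x; have /andP[] := tabP x x; rewrite eqxx => /eqP.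
  - move=> x w v' exw; have /andP[_ /allP/(_ (index w t))] := tabP x v'.
    rewrite mem_iota add0n ti tE -tE !tn exw => /(_ isT) /=.
    by rewrite wtE // -natrD ler_nat.
  move=> x v' xv; have /andP[+ _] := tabP x v'.
  rewrite ifN; last by apply: contra xv => /eqP /inj ->.
  case/hasP=> l; rewrite mem_iota add0n => lt; rewrite tE -tE tn.
  case/andP=> exw /eqP E; exists (nth u0 t l) => //.
  by rewrite wtE // -natrD /D E index_uniq.
move=> x0 i j l it jt lt _ _ _; rewrite (induced_btw dE) /D.
by rewrite !index_uniq.
Qed.

End Models.

(** * The sporadic graphs *)

Section NamedModels.
Import GRing.Theory.
Variable R : realType.

Definition models (W : wgraph R) (k : nat) (d : seq (seq nat)) :=
  exists t : seq W, [/\ uniq t, forall u, u \in t, size t = k &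
    @realizes (induced W) d t].

Lemma mem_uniq_card (T : finType) (t : seq T) :
  uniq t -> size t = #|T| -> forall u, u \in t.
Proof.
move=> /card_uniqP ut st u.
have /subset_cardP : #|t| = #|T| by rewrite ut.
by move=> /(_ (subset_predT _)) /(_ u) ->.
Qed.

Lemma table_models (W : wgraph R) (t : seq W) wt d : uniq t -> size t = #|W| ->
  (forall u v, edge u v -> weight u v = ((wt u v : nat)%:R)%R) ->
  distance_table t wt d -> models W (size t) d.
Proof.
move=> ut st wtE tab; have tW := mem_uniq_card ut st.
by exists t; split=> //; apply: induced_realizes wtE tab.
Qed.

Lemma models_cosize W k d : models W k d ->
  #|induced W| = k /\ cosize (induced W) = ntri d k.
Proof.
case=> t [ut tW st dt]; split.
  by rewrite -st -(card_uniqP ut); apply: eq_card => u; rewrite tW.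
have tE : [set: induced W] = [set u in (t : seq (induced W))].
  by apply/setP => u; rewrite !inE tW.
by rewrite cosizeE tE (card_triangles_realizes (B := induced W) ut dt) st.
Qed.

Lemma models_isomorphic (B : betweenness) W k d (s : seq B) : models W k d ->
  uniq s -> [set: B] = [set x in s] -> size s = k -> realizes d s ->
  isomorphic B (induced W).
Proof.
case=> t [ut tW st dt] us sB ss ds.
apply: (@isomorphic_realizes B (induced W) d s t us _ ut tW ds dt); last by rewrite ss.
by move=> x; have := in_setT x; rewrite sB inE.
Qed.

Local Notation o n k := (@Ordinal n k isT).
Local Notation one := (fun _ _ => 1).

Lemma K3_models : models (K3 R) 3 tblK3.
Proof.
apply: (@table_models (K3 R) [:: o 3 0; o 3 1; o 3 2] one) => //.
  by rewrite /= card_ord.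
Qed.

Lemma K13_models : models (K13 R) 4 tblK13.
Proof.
apply: (@table_models (K13 R)
  [:: inl (o 1 0); inr (o 3 0); inr (o 3 1); inr (o 3 2)] one) => //.
by rewrite card_sum !card_ord.
Qed.

Lemma C4_1122_models : models (C4_1122 R) 4 tblC4_1122.
Proof.
apply: (@table_models (C4_1122 R) [:: o 4 0; o 4 1; o 4 2; o 4 3]
  (fun u v : 'I_4 => if v == ordS u then if u < 2 then 1 else 2
    else if v < 2 then 1 else 2)) => //.
  by rewrite card_ord.
move=> u v _; rewrite /= /cycle_weight /C4_1122_weight.
by do 2?case: ifP.
Qed.

Lemma K23_models : models (K23 R) 5 tblK23.
Proof.
apply: (@table_models (K23 R)
  [:: inl (o 2 0); inl (o 2 1); inr (o 3 0); inr (o 3 1); inr (o 3 2)] one) => //.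
by rewrite card_sum !card_ord.
Qed.

Definition vertices33 : seq ('I_3 + 'I_3) := [:: inl (o 3 0); inl (o 3 1);
  inl (o 3 2); inr (o 3 0); inr (o 3 1); inr (o 3 2)].

Lemma K33_models : models (K33 R) 6 tblK33.
Proof.
apply: (@table_models (K33 R) vertices33 one) => //.
by rewrite card_sum !card_ord.
Qed.

Lemma K33_minus1_models : models (K33_minus1 R) 6 tblK33_minus1.
Proof.
apply: (@table_models (K33_minus1 R) vertices33 one) => //.
by rewrite card_sum !card_ord.
Qed.

Lemma K33_minus2_models : models (K33_minus2 R) 6 tblK33_minus2.
Proof.
apply: (@table_models (K33_minus2 R) vertices33 one) => //.
by rewrite card_sum !card_ord.
Qed.

Lemma C6_models : models (C6 R) 6 tblC6.
Proof.
apply: (@table_models (C6 R)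
  [:: o 6 0; o 6 1; o 6 2; o 6 3; o 6 4; o 6 5] one) => //.
- by rewrite card_ord.
by move=> u v _; rewrite /= /cycle_weight; case: ifP.
Qed.

Definition vertices5 : seq ('I_(5 - 2) + bool) := [:: inl (o 3 0); inl (o 3 1);
  inl (o 3 2); inr false; inr true].

(** Order 5 belongs to the families but is classified by the search, so its members need tables too.
    The only index in [I4 5] is 1. *)
Lemma R5_models n_ge5 iI : models (@R4 R 5 1 n_ge5 iI) 5 tblR5.
Proof.
apply: (@table_models (@R4 R 5 1 n_ge5 iI) vertices5 one) => //.
by rewrite card_sum card_ord card_bool.
Qed.

Lemma S5_models n_ge5 : models (@S4 R 5 n_ge5) 5 tblS5.
Proof.
apply: (@table_models (@S4 R 5 n_ge5) vertices5
  (fun u v : 'I_(5 - 2) + bool => if (u, v) is (inr _, inr _) then 2 else 1)) => //.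
  by rewrite card_sum card_ord card_bool.
by move=> [a|a] [b|b].
Qed.

End NamedModels.

(** * The families R and S *)

(** The distance on the line: one of the two truncated differences is 0. *)
Definition gap (a b : nat) : nat := (a - b) + (b - a).

Lemma gap_btw a b c :
  (gap a c == gap a b + gap b c) = (a <= b <= c) || (c <= b <= a).
Proof. by rewrite /gap; lia. Qed.

Lemma gapC a b : gap a b = gap b a.
Proof. exact: addnC. Qed.

(* In [R4], the points y and z occupy the same position of the path. *)
Definition R4_pos (m i : nat) (u : 'I_m + bool) : nat :=
  if u is inl a then if a < i then a : nat else a.+1 else i.

Definition R4_dist (m i : nat) (u v : 'I_m + bool) : nat :=
  match u, v with
  | inr b, inr c => if b == c then 0 else 2
  | _, _ => gap (R4_pos i u) (R4_pos i v)
  end.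

Definition S4_pos (m : nat) (u : 'I_m + bool) : nat :=
  match u with inl a => a.+1 | inr b => if b then m.+1 else 0 end.

(** The edge from y to z has weight n - 3 = m - 1, shorter than the m + 1 along the path, yet it
    changes no other distance: from x_1 to z both routes have length m. This tie puts y between x_1
    and z, and symmetrically z between y and x_m. *)
Definition S4_dist (m : nat) (u v : 'I_m + bool) : nat :=
  match u, v with
  | inr b, inr c => if b == c then 0 else m.-1
  | _, _ => gap (S4_pos u) (S4_pos v)
  end.

Section Distances.
Import GRing.Theory Num.Theory.
Variables (R : realType) (n i : nat).
Hypothesis n_ge5 : 5 <= n.
Local Notation m := (n - 2).

Lemma dist_R4 (iI : I4 n i) u v : @dist R (R4 R n_ge5 iI) u v = (R4_dist i u v)%:R%R.
Proof.
have /andP[i0 im] := iI.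
have im' : i < m by lia.
have pm : i.-1 < m by lia.
move: u v; apply: dist_potential.
- by case=> [a|b]; rewrite /R4_dist /gap ?eqxx ?subnn.
- move=> u w v /= e; rewrite addrC natr1 ler_nat.
  by case: u w v e => [a|b] [a'|b'] [a''|b''] //=;
    rewrite /R4_dist /gap /R4_pos; do 5?case: ifP; lia.
move=> u v uv; rewrite /=.
(* From a path vertex, the next vertex towards [v] is a neighbour on the path, except at the deleted
   edge, where it is y, or [v] itself when that is y or z. *)
suff [w e E] : exists2 w, R4_edge i u w & R4_dist i u v = (R4_dist i w v).+1.
  by exists w => //; rewrite E -natr1 addrC.
case: u v uv => [a|b] [a'|b'] uv.
- have aa' : a <> a' :> nat by move=> E; case/eqP: uv; congr inl; apply: val_inj.
  have [lt|gt] := ltnP a a'.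
    have [ai|ai] := eqVneq a.+1 i.
      exists (inr false); first by rewrite /= ai eqxx.
      by rewrite /R4_dist /gap /R4_pos; do 2?case: ifP; lia.
    have h : a.+1 < m by have := ltn_ord a'; lia.
    exists (inl (Ordinal h)); first by rewrite /= eqxx ai.
    by rewrite /R4_dist /gap /R4_pos /=; do 3?case: ifP; lia.
  have [ai|ai] := eqVneq (a : nat) i.
    exists (inr false); first by rewrite /= ai eqxx orbT.
    by rewrite /R4_dist /gap /R4_pos; do 2?case: ifP; lia.
  have h : a.-1 < m by have := ltn_ord a; lia.
  exists (inl (Ordinal h)); first by rewrite /=; lia.
  by rewrite /R4_dist /gap /R4_pos /=; do 3?case: ifP; lia.
- have [lt|gt] := ltnP a i.
    have [ai|ai] := eqVneq a.+1 i.
      exists (inr b'); first by rewrite /= ai eqxx.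
      by rewrite /R4_dist /gap /R4_pos eqxx; do 2?case: ifP; lia.
    have h : a.+1 < m by have := ltn_ord a; lia.
    exists (inl (Ordinal h)); first by rewrite /= eqxx ai.
    by rewrite /R4_dist /gap /R4_pos /=; do 3?case: ifP; lia.
  have [ai|ai] := eqVneq (a : nat) i.
    exists (inr b'); first by rewrite /= ai eqxx orbT.
    by rewrite /R4_dist /gap /R4_pos eqxx; do 2?case: ifP; lia.
  have h : a.-1 < m by have := ltn_ord a; lia.
  exists (inl (Ordinal h)); first by rewrite /=; lia.
  by rewrite /R4_dist /gap /R4_pos /=; do 3?case: ifP; lia.
- have [lt|gt] := ltnP a' i.
    exists (inl (Ordinal pm)); first by rewrite /= prednK // eqxx.
    by rewrite /R4_dist /gap /R4_pos /=; do 3?case: ifP; lia.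
  exists (inl (Ordinal im')); first by rewrite /= eqxx orbT.
  by rewrite /R4_dist /gap /R4_pos /=; do 3?case: ifP; lia.
have bb' : b != b' by apply: contra uv => /eqP ->.
exists (inl (Ordinal im')); first by rewrite /= eqxx orbT.
by rewrite /R4_dist (negbTE bb') /gap /R4_pos /= ltnn; lia.
Qed.

Lemma dist_S4 u v : @dist R (S4 R n_ge5) u v = (S4_dist u v)%:R%R.
Proof.
have m0 : 0 < m by lia.
have lm : m.-1 < m by lia.
have wE (x w : 'I_m + bool) : S4_weight R x w =
    ((if (x, w) is (inr _, inr _) then m.-1 else 1) : nat)%:R%R.
  by case: x w => [a|b] [a'|b'] //=; rewrite /S4_weight -subn1 -subnDA.
move: u v; apply: dist_potential.
- by case=> [a|b]; rewrite /S4_dist /gap ?eqxx ?subnn.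
- move=> u w v /= e; rewrite wE -natrD ler_nat.
  by case: u w v e => [[a ha]|[]] [[a' ha']|[]] [[a'' ha'']|[]] //=;
    rewrite /S4_dist /gap /S4_pos; lia.
move=> u v uv; rewrite /=.
suff [w e E] : exists2 w, S4_edge u w &
    S4_dist u v = (if (u, w) is (inr _, inr _) then m.-1 else 1) + S4_dist w v.
  by exists w => //; rewrite E wE natrD.
have up (a : 'I_m) v' : S4_pos (inl a) < S4_pos v' -> exists2 w, S4_edge (inl a) w &
    S4_dist (inl a) v' = 1 + S4_dist w v'.
  move=> lt; have [h|h] := ltnP a.+1 m.
    exists (inl (Ordinal h)); first by rewrite /= eqxx.
    by case: v' lt => [[a' ha']|[]]; rewrite /S4_dist /gap /S4_pos /=; lia.
  exists (inr true); first by rewrite /=; have := ltn_ord a; lia.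
  by case: v' lt => [[a' ha']|[]]; rewrite /S4_dist /gap /S4_pos /=; lia.
have down (a : 'I_m) v' : S4_pos v' < S4_pos (inl a) -> exists2 w, S4_edge (inl a) w &
    S4_dist (inl a) v' = 1 + S4_dist w v'.
  move=> lt; have [h|h] := posnP a.
    exists (inr false); first by rewrite /= h.
    by case: v' lt => [[a' ha']|[]]; rewrite /S4_dist /gap /S4_pos /=; lia.
  have h' : a.-1 < m by have := ltn_ord a; lia.
  exists (inl (Ordinal h')); first by rewrite /=; lia.
  by case: v' lt => [[a' ha']|[]]; rewrite /S4_dist /gap /S4_pos /=; lia.
case: u v uv => [a|b] v uv.
  have ne : S4_pos v != S4_pos (inl a).
    apply: contra uv => /eqP; case: v => [a'|[]] /=; have := ltn_ord a; try lia.
    by move=> _ [E]; apply/eqP; congr inl; apply: val_inj.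
  by have [/down|/up|E] := ltngtP (S4_pos v) (S4_pos (inl a)); rewrite ?E ?eqxx // in ne *.
case: v uv => [a'|b'] uv.
  case: b {uv}.
    exists (inl (Ordinal lm)); first by rewrite /=; lia.
    by have := ltn_ord a'; rewrite /S4_dist /gap /S4_pos /=; lia.
  exists (inl (Ordinal m0)); first by rewrite /=.
  by have := ltn_ord a'; rewrite /S4_dist /gap /S4_pos /=; lia.
have bb' : b != b' by apply: contra uv => /eqP ->.
by exists (inr b') => //; rewrite /S4_dist (negbTE bb') eqxx addn0.
Qed.

End Distances.

(** * Co-size of the families, and their recognition from the shapes *)

Section Families.
Variables (R : realType) (n : nat).
Hypothesis n_ge5 : 5 <= n.
Local Notation m := (n - 2).
Local Notation vertex := ('I_m + bool)%type.
Local Notation "'y" := (inr false : vertex) (at level 0).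
Local Notation "'z" := (inr true : vertex) (at level 0).

Definition path_vertices : seq vertex := [seq inl a | a <- enum 'I_m].

Lemma size_path_vertices : size path_vertices = m.
Proof. by rewrite size_map size_enum_ord. Qed.

Lemma mem_path_vertices (u : vertex) : (u \in path_vertices) = (u \notin [:: 'y; 'z]).
Proof.
case: u => [a|b].
  by rewrite mem_map ?mem_enum // => ? ? [].
by rewrite !inE; case: b; apply/mapP => -[].
Qed.

Lemma path_vertices_uniq : uniq ('y :: 'z :: path_vertices).
Proof.
rewrite /= inE !mem_path_vertices !inE /= map_inj_uniq ?enum_uniq //.
by move=> ? ? [].
Qed.

Lemma count_two (P : pred 'I_m) (i1 i2 : 'I_m) : i1 != i2 ->
  (forall a, P a = (a == i1) || (a == i2)) -> count P (enum 'I_m) = 2.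
Proof.
move=> i12 PE; rewrite -size_filter -(card_uniqP (filter_uniq _ (enum_uniq _))).
transitivity #|pred2 i1 i2|; last by rewrite card2 i12.
by apply: eq_card => a; rewrite mem_filter mem_enum andbT PE.
Qed.

(** Away from y, or away from z, distances are gaps between positions on a line, where any three
    points are collinear. So every triangle contains both y and z, and [count_aligned] applies. In
    both uses [f] is the identity; it separates [vertex] from the vertex type of [W]. *)
Lemma family_cosize (W : wgraph R) (D : vertex -> vertex -> nat) pos
    (i1 i2 : 'I_m) (f : vertex -> W) : bijective f ->
  (forall u v w, @btw (induced W) (f u) (f v) (f w) = (D u w == D u v + D v w)) ->
  (forall b u v, u != inr b -> v != inr b -> D u v = gap (pos u) (pos v)) ->
  i1 != i2 ->
  (forall a, [|| D 'y (inl a) == D 'y 'z + D 'z (inl a),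
     D 'z (inl a) == D 'z 'y + D 'y (inl a) |
     D 'y 'z == D 'y (inl a) + D (inl a) 'z] = (a == i1) || (a == i2)) ->
  cosize (induced W) = n - 4.
Proof.
move=> bf fE DE i12 al; have inj := bij_inj bf; have [g fK gK] := bf.
pose s := map f path_vertices.
have us : uniq (f 'y :: f 'z :: s).
  by rewrite (map_inj_uniq inj ('y :: 'z :: path_vertices)) path_vertices_uniq.
have all_s (x : induced W) : x \in f 'y :: f 'z :: s.
  rewrite -(gK x) (mem_map inj ('y :: 'z :: path_vertices)).
  rewrite !inE mem_path_vertices !inE negb_or.
  by case: (g x) => [a|[]].
have sp : spine [set: induced W] (f 'y) (f 'z).
  split; first by rewrite (inj_eq inj).
  move=> A; rewrite inE => /andP[trA _].
  have [u [v [w [AE uv vw uw]]]] := triangleP trA.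
  suff key b : f (inr b) \in A by split; apply: key.
  apply/negPn/negP; rewrite AE !inE -{1}(gK u) -{1}(gK v) -{1}(gK w) !(inj_eq inj).
  rewrite !negb_or => /andP[/andP[ub vb] wb].
  move: trA; rewrite AE triangle3 // /label -(gK u) -(gK v) -(gK w) !fE.
  rewrite !(DE b) 1?eq_sym // !gap_btw.
  by do 3?case: ifP => //; clear; lia.
have := @count_aligned (induced W) s _ _ us all_s sp; rewrite -cosizeE size_map size_path_vertices.
suff -> : count (@aligned (induced W) (f 'y) (f 'z)) s = 2 by lia.
rewrite 2!count_map; apply: (count_two i12) => a.
by rewrite /= /aligned !fE al.
Qed.

Lemma cosize_R4 i (iI : I4 n i) : cosize (induced (R4 R n_ge5 iI)) = n - 4.
Proof.
have /andP[i0 im] := iI; have im' : i < m by lia.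
have pm : i.-1 < m by lia.
apply: (@family_cosize (R4 R n_ge5 iI) (@R4_dist m i) (R4_pos i)
  (Ordinal pm) (Ordinal im') id) => //.
- by exists id.
- by move=> u v w; rewrite (induced_btw (@dist_R4 R n i n_ge5 iI)).
- by case=> [] [a|[]] [b|[]]; rewrite /R4_dist /gap //= subnn.
- by apply/eqP => /(congr1 val) /=; lia.
move=> a; rewrite -!val_eqE /= /R4_dist /gap /R4_pos /=.
by case: ifP; lia.
Qed.

Lemma cosize_S4 : cosize (induced (S4 R n_ge5)) = n - 4.
Proof.
have m0 : 0 < m by lia.
have lm : m.-1 < m by lia.
apply: (@family_cosize (S4 R n_ge5) (@S4_dist m) (@S4_pos m)
  (Ordinal m0) (Ordinal lm) id) => //.
- by exists id.
- by move=> u v w; rewrite (induced_btw (@dist_S4 R n n_ge5)).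
- by case=> [] [a|[]] [b|[]]; rewrite /S4_dist /gap //= subnn.
- by apply/eqP => /(congr1 val) /=; lia.
move=> [a am]; rewrite -!val_eqE /= /S4_dist /gap /S4_pos /=; lia.
Qed.

Section FromShape.
Variables (B : betweenness) (x0 : B) (s : seq B) (y z : B).
Hypothesis us : uniq (y :: z :: s).
Hypothesis all_s : forall x, x \in y :: z :: s.
Hypothesis os : ordered s.
Hypothesis sE : size s = m.
Hypothesis coB : cosize B = n - 4.

Definition end_point (b : bool) : B := if b then z else y.

Definition from_vertex (u : vertex) : B :=
  match u with inl a => nth x0 s a | inr b => end_point b end.

Lemma from_vertex_bij : bijective from_vertex.
Proof.
have nE (a : 'I_m) : nth x0 s a \in s by rewrite mem_nth ?sE.
have /and3P[+ zs us'] := us; rewrite inE negb_or => /andP[yz ys].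
apply: inj_card_bij; last first.
  rewrite card_sum card_ord card_bool -sE.
  have <- : size (y :: z :: s) = size s + 2 by rewrite addn2.
  by apply: leq_trans (card_size _); apply/subset_leq_card/subsetP => x _.
have ne b (a : 'I_m) : nth x0 s a != end_point b.
  by case: b; apply: (contraTneq _ (nE a)) => ->.
move=> [a|b] [a'|b'] /=.
- move/eqP; rewrite nth_uniq ?sE // => /eqP E; congr inl; exact: val_inj.
- by move/eqP; rewrite (negbTE (ne _ _)).
- by move/esym/eqP; rewrite (negbTE (ne _ _)).
by case: b b' => [] [] //= E; move: yz; rewrite E eqxx.
Qed.

Lemma ordered_vertices (a b c : 'I_m) : a < b < c \/ c < b < a ->
  btw (nth x0 s a) (nth x0 s b) (nth x0 s c).
Proof.
case=> /andP[h1 h2]; last rewrite btw_sym.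
  by apply: os; rewrite // sE.
by apply: os; rewrite // sE.
Qed.

Lemma twin_isomorphic p (pI : I4 n p) : twin_shape s y z p ->
  isomorphic B (induced (R4 R n_ge5 pI)).
Proof.
move=> [/andP[p0 pm] yp zp tw]; have {tw} [tw1 tw2] := tw x0.
have ins b i j : i < j -> j < m -> if j < p then
    btw (nth x0 s i) (nth x0 s j) (end_point b)
    else if i < p then btw (nth x0 s i) (end_point b) (nth x0 s j)
    else btw (end_point b) (nth x0 s i) (nth x0 s j).
  by rewrite -sE; case: b; [case: zp | case: yp] => _ h; apply: h.
apply: (@isomorphic_forward B (induced (R4 R n_ge5 pI)) from_vertex
  from_vertex_bij); last by rewrite cosize_R4.
move=> u v w uv vw uw; rewrite (induced_btw (@dist_R4 R n p n_ge5 pI)).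
have neq (a a' : 'I_m) : inl a != inl a' :> vertex -> (a : nat) <> a'.
  by move=> ne E; case/eqP: ne; congr inl; apply: val_inj.
(* The letters tell path vertices (L, for [inl]) from y and z (R, for [inr]). *)
have LLR b (a a' : 'I_m) : R4_dist p (inl a) (inr b) ==
    R4_dist p (inl a) (inl a') + R4_dist p (inl a') (inr b) -> (a : nat) <> a' ->
    btw (nth x0 s a) (nth x0 s a') (end_point b).
  rewrite /R4_dist gap_btw /R4_pos => h aa'; have [lt|gt] := ltnP a a'.
    have := ins b _ _ lt (ltn_ord a'); case: (ltnP a' p) => // ap.
    by move: h; rewrite (ltnNge a') ap /=; case: ifP; clear -lt ap; lia.
  have gt' : a' < a by rewrite ltn_neqAle gt andbT; apply/eqP/nesym.
  have := ins b _ _ gt' (ltn_ord a); rewrite [in X in _ -> X]btw_sym.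
  by move: h; case: (ltnP a p) => ap; case: (ltnP a' p) => ap' //; clear -gt' ap ap'; lia.
have RLR b b' (a : 'I_m) : b != b' -> R4_dist p (inr b : vertex) (inr b') ==
    R4_dist p (inr b) (inl a) + R4_dist p (inl a) (inr b') ->
    btw (end_point b) (nth x0 s a) (end_point b').
  move=> bb'; rewrite /R4_dist (negbTE bb') => h.
  (* The distance 2 from y to z can only split as 1 + 1, at the two neighbours of the slot. *)
  have [aE|aE] : a = p.-1 :> nat \/ a = p :> nat.
    by move: h; rewrite /gap /R4_pos; case: ifP; clear -p0; lia.
  - by clear h; case: b b' bb' => [] [] // _; rewrite aE ?[btw z _ _]btw_sym.
  by clear h; case: b b' bb' => [] [] // _; rewrite aE ?[btw z _ _]btw_sym.
have sym (a b : vertex) : R4_dist p a b = R4_dist p b a.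
  by case: a b => [a|a] [b|b]; rewrite /R4_dist /gap 1?eq_sym // addnC.
case: u v w uv vw uw => [a|b] [a'|b'] [a''|b''] uv vw uw h /=.
- apply: ordered_vertices; have := neq _ _ uv; have := neq _ _ vw.
  by move: h; rewrite /R4_dist gap_btw /R4_pos; do 3?case: ifP; clear; lia.
- exact: LLR h (neq _ _ uv).
- have aa' := neq _ _ uw; have [lt|gt] := ltnP a a''.
    have := ins b' _ _ lt (ltn_ord a''); move: h; rewrite /R4_dist gap_btw /R4_pos.
    by case: (ltnP a'' p) => c1; case: (ltnP a p) => c2 //; clear -lt c1 c2; lia.
  have gt' : a'' < a by rewrite ltn_neqAle gt andbT; apply/eqP/nesym.
  have := ins b' _ _ gt' (ltn_ord a); move: h; rewrite /R4_dist gap_btw /R4_pos.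
  case: (ltnP a p) => c1; case: (ltnP a'' p) => c2;
    try (by clear -gt' c1 c2; lia).
  by move=> _; rewrite btw_sym.
- move: h; rewrite /R4_dist (negbTE (vw : b' != b'')) /R4_pos; clear; lia.
- rewrite btw_sym; apply: LLR; last by apply/nesym/neq.
  by rewrite (sym (inl a'') (inr b)) (sym (inl a'') (inl a')) (sym _ (inr b)) addnC.
- exact: RLR.
- move: h; rewrite /R4_dist (negbTE (uv : b != b')) /R4_pos; clear; lia.
by move: uv vw uw; case: (b) (b') (b'') => [] [] [].
Qed.

Lemma end_isomorphic : end_shape s y z -> isomorphic B (induced (S4 R n_ge5)).
Proof.
move=> [[_ yp] [_ zp] sh]; have {sh} [sh1 sh2] := sh x0.
rewrite sE in yp zp sh2.
have yN i j : i < j -> j < m -> btw y (nth x0 s i) (nth x0 s j).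
  by move=> ij jm; apply: yp.
have zN i j : i < j -> j < m -> btw (nth x0 s i) (nth x0 s j) z.
  by move=> ij jm; have := zp x0 i j ij jm; rewrite jm.
apply: (@isomorphic_forward B (induced (S4 R n_ge5)) from_vertex from_vertex_bij);
  last by rewrite cosize_S4.
move=> u v w uv vw uw; rewrite (induced_btw (@dist_S4 R n n_ge5)).
have neq (a a' : 'I_m) : inl a != inl a' :> vertex -> (a : nat) <> a'.
  by move=> ne E; case/eqP: ne; congr inl; apply: val_inj.
have LLR b (a a' : 'I_m) : S4_dist (inl a) (inr b) ==
    S4_dist (inl a) (inl a') + S4_dist (inl a') (inr b) -> (a : nat) <> a' ->
    btw (nth x0 s a) (nth x0 s a') (end_point b).
  have am := ltn_ord a; have am' := ltn_ord a'.
  rewrite /S4_dist gap_btw /S4_pos; case: b => h aa'; last rewrite btw_sym.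
    by apply: zN => //; clear -h aa' am am'; lia.
  by apply: yN => //; clear -h aa' am am'; lia.
(* From y the equation is a + 1 = (m - 1) + (m - a), so a = m - 1; from z it is m - a = (m - 1) + (a
   + 1), so a = 0. *)
have RRL b b' (a : 'I_m) : b != b' -> S4_dist (inr b) (inl a) ==
    S4_dist (inr b : vertex) (inr b') + S4_dist (inr b') (inl a) ->
    btw (end_point b) (end_point b') (nth x0 s a).
  have am := ltn_ord a.
  case: b b' => [] [] // _; rewrite /S4_dist /gap /S4_pos /= => h.
    have -> : a = 0 :> nat by clear -h am; lia.
    by rewrite btw_sym.
  by have -> : a = m.-1 :> nat by clear -h am; lia.
have sym (a b : vertex) : S4_dist a b = S4_dist b a.
  by case: a b => [a|a] [b|b]; rewrite /S4_dist 1?gapC // eq_sym.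
case: u v w uv vw uw => [a|b] [a'|b'] [a''|b''] uv vw uw h /=.
- apply: ordered_vertices; have := neq _ _ uv; have := neq _ _ vw.
  by move: h; rewrite /S4_dist gap_btw /S4_pos; clear; lia.
- exact: LLR h (neq _ _ uv).
- have am := ltn_ord a; have am' := ltn_ord a''.
  by move: h; rewrite /S4_dist gap_btw /S4_pos; case: (b'); clear -am am'; lia.
- rewrite btw_sym; apply: RRL; first by rewrite eq_sym.
  by rewrite (sym _ (inl a)) (sym (inr b'')) (sym _ (inl a)) addnC.
- rewrite btw_sym; apply: LLR; last by apply/nesym/neq.
  by rewrite (sym (inl a'') (inr b)) (sym (inl a'') (inl a')) (sym _ (inr b)) addnC.
- have am := ltn_ord a'; move: h; rewrite /S4_dist (negbTE (uw : b != b'')) /gap /S4_pos.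
  by case: (b) (b'') uw => [] [] // _; clear -am; lia.
- exact: RRL.
by move: uv vw uw; case: (b) (b') (b'') => [] [] [].
Qed.

End FromShape.
End Families.

(** * Classification *)

Lemma cosize_ge (B : betweenness) : 0 < cosize B -> maxn 1 (#|B| - 4) <= cosize B.
Proof.
move=> c0; rewrite geq_max c0 cosizeE -cardsT triangles_ge //.
by rewrite -cosizeE.
Qed.

Lemma card_sum_family m : #|{: 'I_m + bool}| = m + 2.
Proof. by rewrite card_sum card_ord card_bool. Qed.

Lemma tau0 (R : realType) n : 3 <= n -> is_tau n 0 (maxn 1 (n - 4)).
Proof.
move=> n3; split=> [||k + [B nE kE]]; first exact: leq_maxl; last first.
  by rewrite -nE -kE; apply: cosize_ge.
have [n_ge5|] := leqP 5 n.
  have iI : I4 n 1 by rewrite /I4; lia.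
  exists (induced (R4 R n_ge5 iI)); last by rewrite cosize_R4; lia.
  by rewrite card_sum_family; lia.
move=> n4; have [->|->] : n = 3 \/ n = 4 by lia.
  by have [? ?] := models_cosize (K3_models R); exists (induced (K3 R)).
by have [? ?] := models_cosize (K13_models R); exists (induced (K13 R)).
Qed.

Lemma quasilinearE (R : realType) (B : betweenness) : 3 <= #|B| ->
  quasilinear B <-> cosize B = maxn 1 (#|B| - 4).
Proof.
move=> B3; have t0 := tau0 R B3; split=> [[c0 _ min]|E]; last by rewrite /quasilinear E.
have [m0 real _] := t0; apply/eqP; rewrite eqn_leq cosize_ge // andbT.
exact: min.
Qed.

Section Classification.
Variables (R : realType) (B : betweenness).

Lemma listed_models ds : listed ds [set: B] -> exists2 d, d \in ds &
  cosize B = ntri d #|B| /\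
  forall W, models (R := R) W #|B| d -> isomorphic B (induced W).
Proof.
case=> s [d [us sE dd ds_s]]; exists d => //.
have ss : size s = #|B| by rewrite -cardsT sE card_set_seq.
split; first by rewrite cosizeE sE (card_triangles_realizes us ds_s) ss.
by move=> W mW; apply: models_isomorphic mW us sE ss ds_s.
Qed.

Lemma spine_isomorphic y z : 6 <= #|B| -> cosize B = #|B| - 4 ->
  spine [set: B] y z ->
  (exists n i (n_ge5 : 5 <= n) (iI : I4 n i), isomorphic B (induced (R4 R n_ge5 iI)))
  \/ (exists n (n_ge5 : 5 <= n), isomorphic B (induced (S4 R n_ge5))).
Proof.
move=> B6 co sp; have n_ge5 : 5 <= #|B| by lia.
have [s [y' [z' [us all_s os shape]]]] := spine_shape B6 co sp.
have sE : size s = #|B| - 2.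
  have : #|B| = size (y' :: z' :: s).
    by rewrite -(card_uniqP us); apply: eq_card => x; rewrite all_s.
  by move=> ->; rewrite /= subn2.
case: shape => [[p tw]|en]; last first.
  by right; exists #|B|, n_ge5; apply: (@end_isomorphic _ _ _ _ y' s y' z').
left; exists #|B|; have [/andP[p0 pm] yp zp mid] := tw.
have [ple|pgt] := leqP p (uphalf (#|B| - 3)).
  have pI : I4 #|B| p by rewrite /I4 p0.
  by exists p, n_ge5, pI; apply: (@twin_isomorphic _ _ _ _ y' s y' z').
(* Reversing the path moves slot [p] to n - 2 - p, which satisfies [I4] when [p] is past the
   middle. *)
pose q := size s - p.
have qI : I4 #|B| q by rewrite /I4 /q sE; lia.
exists q, n_ge5, qI; apply: (@twin_isomorphic _ _ _ _ y' (rev s) y' z') => //.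
- by move: us; rewrite /= !inE !mem_rev rev_uniq.
- by move=> x; have := all_s x; rewrite !inE mem_rev.
- exact: ordered_rev.
- by rewrite size_rev.
split; rewrite ?size_rev; [by rewrite /q; lia|exact: inserted_rev|exact: inserted_rev|].
move=> x0; have [m1 m2] := mid x0.
rewrite !nth_rev /q; try lia.
have -> : size s - (size s - p).+1 = p.-1 by lia.
have -> : size s - (size s - p).-1.+1 = p by lia.
by split.
Qed.

End Classification.

Theorem theorem1 (R : realType) :
  (forall n : nat, 3 <= n -> is_tau n 0 (maxn 1 (n - 4)))
  /\
  (forall B : betweenness, 3 <= #|B| ->
     (quasilinear B <->
      ((exists (n i : nat) (n_ge5 : 5 <= n) (iI : I4 n i),
          isomorphic B (induced (@R4 R n i n_ge5 iI)))
       \/ (exists (n : nat) (n_ge5 : 5 <= n),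
             isomorphic B (induced (@S4 R n n_ge5)))
       \/ isomorphic B (induced (K3 R))
       \/ isomorphic B (induced (K13 R))
       \/ isomorphic B (induced (C4_1122 R))
       \/ isomorphic B (induced (K23 R))
       \/ isomorphic B (induced (K33 R))
       \/ isomorphic B (induced (K33_minus1 R))
       \/ isomorphic B (induced (K33_minus2 R))
       \/ isomorphic B (induced (C6 R))))).
Proof.
split=> [n|B B3]; first exact: tau0.
rewrite (quasilinearE R B3); split=> [co|]; last first.
  have small W k d : models (R := R) W k d -> isomorphic B (induced W) ->
      ntri d k = maxn 1 (k - 4) -> cosize B = maxn 1 (#|B| - 4).
    move=> /models_cosize[cW coW] iso E.
    by rewrite (isomorphic_cosize iso) (isomorphic_card iso) cW coW.
  case=> [[n [i [n5 [iI iso]]]]|[[n [n5 iso]]|]].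
  - rewrite (isomorphic_cosize iso) (isomorphic_card iso) cosize_R4.
    by rewrite card_sum_family; lia.
  - rewrite (isomorphic_cosize iso) (isomorphic_card iso) cosize_S4.
    by rewrite card_sum_family; lia.
  case=> [iso|[iso|[iso|[iso|[iso|[iso|[iso|iso]]]]]]].
  - by apply: small (K3_models R) iso _.
  - by apply: small (K13_models R) iso _.
  - by apply: small (C4_1122_models R) iso _.
  - by apply: small (K23_models R) iso _.
  - by apply: small (K33_models R) iso _.
  - by apply: small (K33_minus1_models R) iso _.
  - by apply: small (K33_minus2_models R) iso _.
  by apply: small (C6_models R) iso _.
have [B7|B6] := leqP 7 #|B|.
  have co' : cosize B = #|B| - 4 by lia.
  have [||y [z sp]] := @spine7 B [set: B]; rewrite ?cardsT -?cosizeE //.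
  by have [] := spine_isomorphic R _ co' sp; [lia|left|right; left].
have [E|B6'] := eqVneq #|B| 6.
  have cB : #|[set: B]| = 6 by rewrite cardsT.
  have ct : #|triangles [set: B]| = 2 by rewrite -cosizeE co E.
  have [[y [z sp]]|] := spine6 cB ct.
    have B6e : 6 <= #|B| by rewrite E.
    have co' : cosize B = #|B| - 4 by rewrite co E.
    by have [] := spine_isomorphic R B6e co' sp; [left|right; left].
  case/(listed_models R) => d; rewrite /order6 !inE E.
  case/or4P=> /eqP -> [_ iso]; do 6!right.
  - by left; apply: iso (K33_models R).
  - by right; left; apply: iso (K33_minus1_models R).
  - by do 2!right; left; apply: iso (K33_minus2_models R).
  by do 3!right; apply: iso (C6_models R).
have [E|B5] := eqVneq #|B| 5.
  rewrite E in co; have := @listed_order5 B [set: B].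
  rewrite cardsT -cosizeE co E => /(_ erefl isT) /(listed_models R)[d].
  (* Co-size 1 discards the triangle-free [tblP5]. *)
  rewrite /order5 !inE E co => /or4P[] /eqP -> [// _ iso].
  - by do 5!right; left; apply: iso (K23_models R).
  - by left; exists 5, 1, isT, isT; apply/iso/R5_models.
  by right; left; exists 5, isT; apply/iso/S5_models.
have [E|B4] := eqVneq #|B| 4.
  rewrite E in co; have := @listed_order4 B [set: B].
  rewrite cardsT -cosizeE co E => /(_ erefl isT) /(listed_models R)[d].
  rewrite /order4 !inE E co => /or4P[] /eqP -> [// _ iso].
  - by do 3!right; left; apply: iso (K13_models R).
  by do 4!right; left; apply: iso (C4_1122_models R).
have E : #|B| = 3 by lia.
rewrite E in co; have := @listed_order3 B [set: B].
rewrite cardsT -cosizeE co E => /(_ erefl isT) /(listed_models R)[d].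
rewrite /order3 !inE E co => /orP[] /eqP -> [// _ iso].
by do 2!right; left; apply: iso (K3_models R).
Qed.
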